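(* Let $(M,\varphi,\xi,\eta,g)$ be a $3$-dimensional almost Kenmotsu manifold. Then the following conditions are equivalent: (a) $M$ is $\eta$-Einstein; (b) $\xi\in N(\kappa)$ for some smooth function $\kappa$ on $M$.
   Context: All manifolds are smooth and connected. An almost contact metric manifold $(M^{2n+1},\varphi,\xi,\eta,g)$ is a manifold with a $(1,1)$-tensor field $\varphi$, a vector field $\xi$, a $1$-form $\eta$ and a Riemannian metric $g$ such that $\varphi^2=-I+\eta\otimes\xi$, $\eta(\xi)=1$ and $g(\varphi X,\varphi Y)=g(X,Y)-\eta(X)\eta(Y)$. Its fundamental $2$-form is $\Phi(X,Y)=g(X,\varphi Y)$. It is almost Kenmotsu if $d\eta=0$ and $d\Phi=2\eta\wedge\Phi$. It is $\eta$-Einstein if its Ricci tensor satisfies $\mathrm{Ric}=a\,g+b\,\eta\otimes\eta$ for some smooth functions $a,b$ on $M$. With $R(X,Y)=[\nabla_X,\nabla_Y]-\nabla_{[X,Y]}$ ($\nabla$ the Levi-Civita connection of $g$), for a smooth function $\kappa$ the $\kappa$-nullity distribution $N(\kappa)$ is defined by $N_p(\kappa)=\{Z\in T_pM \mid R(X,Y)Z=\kappa(g(Y,Z)X-g(X,Z)Y)\ \forall X,Y\in T_pM\}$; $\xi\in N(\kappa)$ means that $R(X,Y)\xi=\kappa(\eta(Y)X-\eta(X)Y)$ for all vector fields $X,Y$. *)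

(* Defs.v *)
From HB Require Import structures.
From mathcomp Require Import all_boot all_order all_algebra.
From mathcomp Require Import all_classical all_reals all_analysis.

Set Implicit Arguments.
Unset Strict Implicit.
Unset Printing Implicit Defensive.
Import Order.TTheory GRing.Theory Num.Theory.
Import numFieldNormedType.Exports.
Local Open Scope classical_set_scope.
Local Open Scope ring_scope.

Section SmoothMaps.
Context {R : realType} {E V : normedModType R}.

(* [U] is meant to be open.  For finite-dimensional [E] this is the usual
   class C^k: the derivative of [f] is C^(k-1) iff all the maps
   [x |-> 'd f x v], with [v] fixed, are. *)
Fixpoint Ck (k : nat) (U : set E) (f : E -> V) : Prop :=
  match k with
  | 0 => forall x, U x -> {for x, continuous f}
  | j.+1 => (forall x, U x -> differentiable f x) /\
            forall v, Ck j U (fun x => 'D_v f x)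
  end.

Definition smooth_on (U : set E) (f : E -> V) : Prop := forall k, Ck k U f.

End SmoothMaps.

(* A smooth atlas of dimension [n], not necessarily maximal.  [coord i] and
   [param i] only matter on [dom i] and on its image.  [chart_at p] is a
   selected chart around [p], used to represent tangent vectors at [p]. *)
Record atlas (R : realType) (n : nat) (M : topologicalType) := Atlas {
  idx : Type;
  dom : idx -> set M;
  coord : idx -> M -> 'rV[R]_n;
  param : idx -> 'rV[R]_n -> M;
  chart_at : M -> idx;
  dom_open : forall i, open (dom i);
  img_open : forall i, open (coord i @` dom i);
  coordK : forall i p, dom i p -> param i (coord i p) = p;
  coord_continuous : forall i p, dom i p -> {for p, continuous (coord i)};
  param_continuous : forall i x, (coord i @` dom i) x ->
    {for x, continuous (param i)};
  transition_smooth : forall i j,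
    smooth_on (coord i @` (dom i `&` dom j)) (coord j \o param i);
  chart_atP : forall p, dom (chart_at p) p
}.

Definition smooth_manifold (R : realType) (n : nat) (M : topologicalType)
    (A : atlas R n M) : Prop :=
  [/\ hausdorff_space M, @second_countable M & connected [set: M]].

Section Manifold.
Context {R : realType} {n : nat} {M : topologicalType}.
Variable A : atlas R n M.

Implicit Types (f : M -> R) (X Y Z W : M -> 'rV[R]_n).

Definition smooth_map {V : normedModType R} (f : M -> V) : Prop :=
  forall i : idx A, smooth_on (coord i @` dom i) (f \o param i).

(* The tangent space at [p] is 'rV[R]_n: [v] stands for the tangent vector
   with components [v] in the chart [chart_at A p].  [tder p v f] is the
   derivative of [f] at [p] along that tangent vector. *)
Definition tder {V : normedModType R} (p : M) (v : 'rV[R]_n) (f : M -> V) : V :=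
  'D_v (f \o param (chart_at A p)) (coord (chart_at A p) p).

Definition act {V : normedModType R} X (f : M -> V) : M -> V :=
  fun p => tder p (X p) f.

(* The components of [X] in the chart [i] are the derivatives along [X] of the
   coordinate functions of [i]; they are required to be smooth on [dom i]. *)
Definition smooth_vf X : Prop :=
  forall i : idx A, smooth_on (coord i @` dom i) (act X (coord i) \o param i).

(* The Lie bracket, as the unique smooth vector field acting on smooth
   functions as the commutator of [X] and [Y]. *)
Definition lie X Y : M -> 'rV[R]_n :=
  xget (fun=> 0) [set Z | smooth_vf Z /\
    forall f, smooth_map f -> act Z f = act X (act Y f) - act Y (act X f)].

Definition one_form (w : M -> 'rV[R]_n -> R) : Prop :=
  (forall p, scalar (w p)) /\
  forall X, smooth_vf X -> smooth_map (fun p => w p (X p)).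

Definition tensor11 (phi : M -> 'rV[R]_n -> 'rV[R]_n) : Prop :=
  (forall p, linear (phi p)) /\
  forall X, smooth_vf X -> smooth_vf (fun p => phi p (X p)).

Definition riemannian (g : M -> 'rV[R]_n -> 'rV[R]_n -> R) : Prop :=
  [/\ forall p u, scalar (g p u),
      forall p u v, g p u v = g p v u,
      forall p u, u != 0 -> 0 < g p u u &
      forall X Y, smooth_vf X -> smooth_vf Y ->
        smooth_map (fun p => g p (X p) (Y p))].

(* Exterior derivatives and the wedge product are normalized without the
   factors 1/2 and 1/3. *)
Definition d_one (w : M -> 'rV[R]_n -> R) X Y : M -> R := fun p =>
  act X (fun q => w q (Y q)) p - act Y (fun q => w q (X q)) p
  - w p (lie X Y p).

Definition d_two (F : M -> 'rV[R]_n -> 'rV[R]_n -> R) X Y Z : M -> R :=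
  fun p =>
    act X (fun q => F q (Y q) (Z q)) p
  + act Y (fun q => F q (Z q) (X q)) p
  + act Z (fun q => F q (X q) (Y q)) p
  - F p (lie X Y p) (Z p) - F p (lie Y Z p) (X p) - F p (lie Z X p) (Y p).

Definition wedge12 (w : M -> 'rV[R]_n -> R)
    (F : M -> 'rV[R]_n -> 'rV[R]_n -> R) (p : M) (u v z : 'rV[R]_n) : R :=
  w p u * F p v z + w p v * F p z u + w p z * F p u v.

Record almost_contact_metric (phi : M -> 'rV[R]_n -> 'rV[R]_n)
    (xi : M -> 'rV[R]_n) (eta : M -> 'rV[R]_n -> R)
    (g : M -> 'rV[R]_n -> 'rV[R]_n -> R) : Prop := AlmostContactMetric {
  acm_phi : tensor11 phi;
  acm_xi : smooth_vf xi;
  acm_eta : one_form eta;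
  acm_g : riemannian g;
  acm_phi2 : forall p v, phi p (phi p v) = - v + eta p v *: xi p;
  acm_eta_xi : forall p, eta p (xi p) = 1;
  acm_compat : forall p u v,
    g p (phi p u) (phi p v) = g p u v - eta p u * eta p v
}.

Definition fundamental_form (phi : M -> 'rV[R]_n -> 'rV[R]_n)
    (g : M -> 'rV[R]_n -> 'rV[R]_n -> R) : M -> 'rV[R]_n -> 'rV[R]_n -> R :=
  fun p u v => g p u (phi p v).

Definition almost_Kenmotsu (phi : M -> 'rV[R]_n -> 'rV[R]_n)
    (xi : M -> 'rV[R]_n) (eta : M -> 'rV[R]_n -> R)
    (g : M -> 'rV[R]_n -> 'rV[R]_n -> R) : Prop :=
  [/\ almost_contact_metric phi xi eta g,
      forall X Y, smooth_vf X -> smooth_vf Y ->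
        forall p, d_one eta X Y p = 0 &
      forall X Y Z, smooth_vf X -> smooth_vf Y -> smooth_vf Z ->
        forall p, d_two (fundamental_form phi g) X Y Z p
          = 2 * wedge12 eta (fundamental_form phi g) p (X p) (Y p) (Z p)].

(* [nabla] is only constrained on smooth vector fields. *)
Record levi_civita (g : M -> 'rV[R]_n -> 'rV[R]_n -> R)
    (nabla : (M -> 'rV[R]_n) -> (M -> 'rV[R]_n) -> M -> 'rV[R]_n) : Prop :=
  LeviCivita {
  lc_smooth : forall X Y, smooth_vf X -> smooth_vf Y -> smooth_vf (nabla X Y);
  lc_addl : forall X Y Z, smooth_vf X -> smooth_vf Y -> smooth_vf Z ->
    nabla (X + Y) Z = nabla X Z + nabla Y Z;
  lc_scalel : forall f X Y, smooth_map f -> smooth_vf X -> smooth_vf Y ->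
    nabla (fun p => f p *: X p) Y = fun p => f p *: nabla X Y p;
  lc_addr : forall X Y Z, smooth_vf X -> smooth_vf Y -> smooth_vf Z ->
    nabla X (Y + Z) = nabla X Y + nabla X Z;
  lc_leibniz : forall f X Y, smooth_map f -> smooth_vf X -> smooth_vf Y ->
    nabla X (fun p => f p *: Y p)
      = fun p => act X f p *: Y p + f p *: nabla X Y p;
  lc_torsion_free : forall X Y, smooth_vf X -> smooth_vf Y ->
    nabla X Y - nabla Y X = lie X Y;
  lc_metric : forall X Y Z, smooth_vf X -> smooth_vf Y -> smooth_vf Z ->
    act X (fun p => g p (Y p) (Z p))
      = fun p => g p (nabla X Y p) (Z p) + g p (Y p) (nabla X Z p)
}.

Section Curvature.
Variable nabla : (M -> 'rV[R]_n) -> (M -> 'rV[R]_n) -> M -> 'rV[R]_n.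

Definition curv X Y Z : M -> 'rV[R]_n :=
  nabla X (nabla Y Z) - nabla Y (nabla X Z) - nabla (lie X Y) Z.

Definition extend (p : M) (v : 'rV[R]_n) : M -> 'rV[R]_n :=
  xget (fun=> 0) [set X | smooth_vf X /\ X p = v].

(* Curvature on tangent vectors at [p]: by tensoriality the choice of smooth
   extensions is immaterial. *)
Definition curv_at (p : M) (u v w : 'rV[R]_n) : 'rV[R]_n :=
  curv (extend p u) (extend p v) (extend p w) p.

Definition Ric (p : M) (v w : 'rV[R]_n) : R :=
  \tr (lin1_mx (fun u => curv_at p u v w)).

Definition eta_Einstein (eta : M -> 'rV[R]_n -> R)
    (g : M -> 'rV[R]_n -> 'rV[R]_n -> R) : Prop :=
  exists a b : M -> R, [/\ smooth_map a, smooth_map b &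
    forall p u v, Ric p u v = a p * g p u v + b p * (eta p u * eta p v)].

Definition nullity (g : M -> 'rV[R]_n -> 'rV[R]_n -> R) (kappa : M -> R)
    (p : M) : set 'rV[R]_n :=
  [set w | forall u v,
     curv_at p u v w = kappa p *: (g p v w *: u - g p u w *: v)].

End Curvature.
End Manifold.

(* Main.v *)
From Pilot Require Import Defs.
From mathcomp Require Import all_boot all_order all_algebra.
From mathcomp Require Import all_classical all_reals all_analysis.
From mathcomp Require Import ring lra.

Set Implicit Arguments.
Unset Strict Implicit.
Unset Printing Implicit Defensive.
Import Order.TTheory GRing.Theory Num.Theory.
Import numFieldNormedType.Exports.
Local Open Scope classical_set_scope.
Local Open Scope ring_scope.

Import Pilot.Defs.

(** The statement is about the curvature tensor at one point, in dimension 3.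

    Fix a point and a vector v with phi v <> 0. The vectors xi, a = phi v and
    b = phi^2 v form an orthogonal frame, with g(a,a) = g(b,b) = q. In this frame
    the Ricci tensor has the components
<<
      Ric(a,b)   = R(xi,a,b,xi)
      Ric(a,xi)  = - R(a,b,xi,b) / q       Ric(b,xi) = R(a,b,xi,a) / q
      Ric(a,a)   = R(xi,a,a,xi) + R(a,b,b,a) / q
      Ric(b,b)   = R(xi,b,b,xi) + R(a,b,b,a) / q
      Ric(xi,xi) = (R(xi,a,a,xi) + R(xi,b,b,xi)) / q
>>
    where R(x,y,z,w) = g(R(x,y)z,w). If Ric = al g + be eta (x) eta, the first
    three vanish and R(xi,a,a,xi) = R(xi,b,b,xi) = q (al + be) / 2, which is
    R(x,y)xi = k (eta(y) x - eta(x) y) with k = (al + be) / 2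
    ([einstein_nullity]). Conversely the latter gives Ric = al g + be eta (x) eta
    with al = k + K, be = 2 k - al, where K is the sectional curvature of the
    plane orthogonal to xi ([nullity_einstein]). Smoothness of k is clear in the
    first case; in the second one K is locally a quotient of smooth functions
    ([nullity_eta_Einstein]).

    Most of the text establishes that the curvature at a point is a tensor with
    the usual symmetries. Tensoriality ([curv_atE]) and the existence of smooth
    fields with a given value ([extendP]) use smooth cutoff functions, built
    from exp(-1/t) and the Hausdorff property ([exists_cutoff]). The symmetries
    follow from the metric property, from the absence of torsion and from the
    Jacobi identity; for this, the bracket, which is defined by its action on
    functions, has to be shown to exist ([lieP]), and that rests on the symmetry
    of second derivatives ([derive_swap]). *)

(** * Functions of class C^k *)

(** Differentiability is defined through the chosen differential ['d f x], so
    the statement is not immediate: the differential of [f] at [x] is a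
    candidate for [g], which makes the choice for [g] a good one. *)
Lemma near_eq_differentiable (R : realType) (V W : normedModType R)
    (f g : V -> W) (x : V) :
  (\forall y \near x, f y = g y) -> differentiable f x -> differentiable g x.
Proof.
move=> fg [[cdf /eqaddoP ef]].
have fgx := nbhs_singleton fg.
have E : g = cst (g (lim (nbhs x))) + 'd f x \o center (lim (nbhs x))
     +o_x (center (lim (nbhs x))).
  apply/eqaddoP => e e0; near=> y.
  rewrite [X in `|X|](_ : _ =
     (f - (cst (f (lim (nbhs x))) + 'd f x \o center (lim (nbhs x)))) y).
    by near: y; apply: ef.
  rewrite !fctE /= lim_id// fgx; congr (_ - _); apply/esym; near: y; exact: fg.
apply/diffP; apply: (@getPex _ (fun df : {linear V -> W} => continuous df /\
  forall y, g y = g (lim (nbhs x)) + df (y - lim (nbhs x))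
                  +o_(y \near x) (y - lim (nbhs x)))).
by exists ('d f x); split => // y; rewrite {1}E.
Unshelve. all: by end_near. Qed.

Section RowVectors.
Context {R : realType} {E : normedModType R} {m : nat}.
Implicit Types h : E -> 'rV[R]_m.

Lemma rV_sum h : h = \sum_(k < m) (fun x => h x 0 k *: 'e_k).
Proof. by apply/funext => x; rewrite fct_sumE -row_sum_delta. Qed.

Lemma continuous_rV h (x : E) : (forall k, {for x, continuous (fun y => h y 0 k)}) ->
  {for x, continuous h}.
Proof.
move=> H; rewrite (rV_sum h).
apply: (big_ind (fun f : E -> 'rV[R]_m => {for x, continuous f})).
- exact: cst_continuous.
- by move=> f g cf cg; apply: continuousD.
- move=> k _; exact: continuousZr_tmp.
Qed.

Lemma differentiable_rVP h (x : E) :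
  differentiable h x <-> forall k, differentiable (fun y => h y 0 k) x.
Proof.
split=> [dh k|H].
  by apply: (@differentiable_comp _ _ _ _ h (fun N : 'rV[R]_m => N 0 k)) => //;
     exact: differentiable_coord.
rewrite (rV_sum h); apply: differentiable_sum => k.
exact: differentiableZl.
Qed.

Lemma derive_coord h (x v : E) k : differentiable h x ->
  'D_v (fun y => h y 0 k) x = ('D_v h x) 0 k.
Proof. by move=> dh; rewrite derive_mx ?mxE//; exact: diff_derivable. Qed.

Lemma derive_compE {F V : normedModType R} (h : E -> F) (f : F -> V) (x v : E) :
  differentiable h x -> differentiable f (h x) ->
  'D_v (f \o h) x = 'D_('D_v h x) f (h x).
Proof.
move=> dh df; rewrite !deriveE//; last exact: differentiable_comp.
by rewrite diff_comp.
Qed.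

End RowVectors.

Section DirectionalDerivatives.
Context {R : realType}  {V : normedModType R}.

Lemma deriveDl {E : normedModType R} (f : E -> V) x u v : differentiable f x ->
  'D_(u + v) f x = 'D_u f x + 'D_v f x.
Proof. by move=> df; rewrite !deriveE ?linearD. Qed.

Lemma deriveZl {E : normedModType R} (f : E -> V) x (a : R) v : differentiable f x ->
  'D_(a *: v) f x = a *: 'D_v f x.
Proof. by move=> df; rewrite !deriveE ?linearZ. Qed.

(** This is what keeps the classes [Ck] stable under composition: it turns the
    varying direction [w] into varying coefficients of fixed directions. *)
Lemma derive_rV {m} (f : 'rV[R]_m -> V) x w : differentiable f x ->
  'D_w f x = \sum_(k < m) w 0 k *: 'D_('e_k) f x.
Proof.
move=> df; rewrite {1}(row_sum_delta w) deriveE// linear_sum.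
by apply: eq_bigr => k _; rewrite linearZ deriveE.
Qed.
End DirectionalDerivatives.

Section CkCalculus.
Context {R : realType} {E : normedModType R}.

Section AnyCodomain.
Context {V : normedModType R}.
Implicit Types (f g : E -> V) (U W : set E).

Lemma Ck_sub k U W f : W `<=` U -> Ck k U f -> Ck k W f.
Proof.
move=> WU; elim: k f => [|k IH] f /=; first by move=> H x /WU /H.
by move=> [d H]; split=> [x /WU /d //|v]; apply: IH.
Qed.

Lemma Ck_local k U f : (forall x, U x -> exists2 W, W x & Ck k W f) -> Ck k U f.
Proof.
elim: k f => [|k IH] f /= H; first by move=> x /H[W Wx]; apply.
split=> [x /H[W Wx [+ _]]|v]; first exact.
by apply: IH => x /H[W Wx [_ /(_ v)]]; exists W.
Qed.

Lemma CkS k U f : Ck k.+1 U f -> Ck k U f.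
Proof.
elim: k f => [|k IH] f; last by move=> /= [d H]; split=> // v; apply: IH.
by move=> [d _] x /d; exact: differentiable_continuous.
Qed.

(** Openness cannot be dropped: the derivatives at a point of [U] depend on the
    values of the function in a whole neighbourhood. *)
Lemma Ck_ext k U f g : open U -> (forall x, U x -> f x = g x) ->
  Ck k U f -> Ck k U g.
Proof.
move=> oU; elim: k f g => [|k IH] f g fg /=.
  move=> cf x Ux; have fgx : \forall y \near x, f y = g y.
    by apply: filterS fg _; exact: open_nbhs_nbhs.
  rewrite /prop_for /continuous_at -fg//.
  by apply: cvg_trans (cf _ Ux); exact: near_eq_cvg.
move=> [df H]; have fgx x : U x -> \forall y \near x, f y = g y.
  by move=> Ux; apply: filterS fg _; exact: open_nbhs_nbhs.
split=> [x Ux|v]; first by apply: near_eq_differentiable (fgx _ Ux) (df _ Ux).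
by apply: IH (H v) => x Ux; apply: near_eq_derive; exact: fgx.
Qed.

Lemma Ck_cst k U (a : V) : Ck k U (cst a).
Proof.
elim: k a => [|k IH] a /=; first by move=> x _; exact: cst_continuous.
split=> [x _|v]; first exact: differentiable_cst.
by rewrite (_ : (fun _ => _) = cst 0)//; apply/funext => x; rewrite derive_cst.
Qed.

Lemma CkD k U f g : open U -> Ck k U f -> Ck k U g -> Ck k U (f \+ g).
Proof.
move=> oU; elim: k f g => [|k IH] f g /=.
  by move=> cf cg x Ux; apply: continuousD; [exact: cf|exact: cg].
move=> [df Hf] [dg Hg]; split=> [x Ux|v].
  by apply: differentiableD; [exact: df|exact: dg].
apply: Ck_ext (IH _ _ (Hf v) (Hg v)) => // x Ux /=.
by rewrite -deriveD//; apply: diff_derivable; [exact: df|exact: dg].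
Qed.

Lemma Ck_sum (I : Type) (r : seq I) k U (F : I -> E -> V) : open U ->
  (forall i, Ck k U (F i)) -> Ck k U (fun x => \sum_(i <- r) F i x).
Proof.
move=> oU H; elim: r => [|i r IH].
  by apply: Ck_ext (Ck_cst k U 0) => // x _; rewrite big_nil.
by apply: Ck_ext (CkD oU (H i) IH) => // x _; rewrite big_cons.
Qed.
End AnyCodomain.

Section RealValued.
Implicit Types (f g : E -> R) (U : set E).

Lemma CkM k U f g : open U -> Ck k U f -> Ck k U g -> Ck k U (f \* g).
Proof.
move=> oU; elim: k f g => [|k IH] f g.
  by move=> cf cg x Ux; apply: continuousM; [exact: cf|exact: cg].
move=> Cf Cg; case: (Cf) => df Hf; case: (Cg) => dg Hg; split=> [x Ux|v].
  by apply: differentiableM; [exact: df|exact: dg].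
have := CkD oU (IH _ _ (CkS Cf) (Hg v)) (IH _ _ (CkS Cg) (Hf v)).
apply: Ck_ext => // x Ux /=.
by rewrite -deriveM//; apply: diff_derivable; [exact: df|exact: dg].
Qed.

Lemma CkN k U f : open U -> Ck k U f -> Ck k U (fun x => - f x).
Proof.
move=> oU Cf; have := CkM oU (Ck_cst k U (-1 : R)) Cf.
apply: Ck_ext => // x Ux /=.
by rewrite mulN1r.
Qed.

Lemma CkB k U f g : open U -> Ck k U f -> Ck k U g -> Ck k U (f \- g).
Proof. by move=> oU Cf Cg; apply: CkD => //; exact: CkN. Qed.

Lemma CkV k U f : open U -> (forall x, U x -> f x != 0) ->
  Ck k U f -> Ck k U (fun x => (f x)^-1).
Proof.
move=> oU f0; elim: k => [|k IH].
  by move=> cf x Ux; apply: (@continuousV); [exact: f0|exact: cf].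
move=> Cf; case: (Cf) => df Hf; split=> [x Ux|v].
  by apply: differentiableV; [exact: df|exact: f0].
have IHf := IH (CkS Cf).
have := CkN oU (CkM oU (CkM oU IHf IHf) (Hf v)).
apply: Ck_ext => // x Ux /=.
rewrite deriveV//; [|exact: f0|by apply: diff_derivable; exact: df].
by rewrite -mulNr expr2 invfM.
Qed.

Lemma Ck_rV m k U (h : E -> 'rV[R]_m) : open U ->
  Ck k U h <-> forall i, Ck k U (fun x => h x 0 i).
Proof.
move=> oU; split.
  elim: k h => [|k IH] h.
    move=> ch i x Ux.
    apply: (@continuous_comp _ _ _ h (fun N : 'rV[R]_m => N 0 i)); first exact: ch.
    exact/differentiable_continuous/differentiable_coord.
  move=> [dh H] i; split=> [x Ux|v]; first by move/differentiable_rVP : (dh x Ux).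
  apply: Ck_ext (IH _ (H v) i) => // x Ux; rewrite derive_coord//; exact: dh.
elim: k h => [|k IH] h H; first by move=> x Ux; apply: continuous_rV => i; exact: H.
have dh x : U x -> differentiable h x.
  by move=> Ux; apply/differentiable_rVP => i; case: (H i) => + _; apply.
split=> // v; apply: IH => i; case: (H i) => _ /(_ v); apply: Ck_ext => // x Ux.
by rewrite derive_coord//; exact: dh.
Qed.

(** By induction, from the chain rule written with partial derivatives,
    D_v (f o h) = sum_i (D_v h)_i * (D_i f o h). *)
Lemma Ck_comp m k U W (h : E -> 'rV[R]_m) (f : 'rV[R]_m -> R) :
  open U -> open W -> (forall x, U x -> W (h x)) ->
  Ck k U h -> Ck k W f -> Ck k U (f \o h).
Proof.
move=> oU oW hUW; elim: k f => [|k IH] f.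
  by move=> ch cf x Ux; apply: continuous_comp; [exact: ch|apply: cf; exact: hUW].
move=> Ch [df Hf]; case: (Ch) => dh Hh.
have dfh x : U x -> differentiable f (h x) by move=> Ux; apply: df; exact: hUW.
split=> [x Ux|v]; first by apply: differentiable_comp; [exact: dh|exact: dfh].
have := @Ck_sum _ _ (index_enum 'I_m) k U (fun i x => ('D_v h x) 0 i * ('D_('e_i) f \o h) x) oU.
move=> /(_ _)/Ck_ext; apply => //.
  move=> x Ux; rewrite (derive_compE _ (dh x Ux) (dfh x Ux)).
  by rewrite (derive_rV _ (dfh x Ux)).
move=> i; apply: CkM => //; last by apply: IH; [exact: CkS|exact: Hf].
by move: i; apply/Ck_rV => //; exact: Hh.
Qed.
End RealValued.
End CkCalculus.

Lemma Ck_id (R : realType) (E : normedModType R) k (U : set E) : Ck k U (id : E -> E).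
Proof.
case: k => [|k]; first by move=> x _; exact: cvg_id.
split=> // v; rewrite (_ : (fun _ => _) = cst v); first exact: Ck_cst.
by apply/funext => x; rewrite derive_id.
Qed.

(** * Symmetry of second derivatives *)

Section Schwarz.
Context {R : realType} {E : normedModType R}.
Implicit Types (f : E -> R) (x u v : E).

Lemma is_derive_line f x u (s : R) : differentiable f (x + s *: u) ->
  is_derive s 1 (fun t : R => f (x + t *: u)) ('D_u f (x + s *: u)).
Proof.
move=> df.
pose h (t : R) := x + t *: u.
have dh : is_derive s (1 : R) h u.
  have -> : h = (cst x + ( *:%R ^~ u))%R by [].
  have dl : differentiable ( *:%R^~ u : R -> E) s by [].
  have du : is_derive s (1 : R) ( *:%R^~ u : R -> E) u.
    apply: DeriveDef; first exact: diff_derivable.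
    by rewrite deriveE// diff_val scale1r.
  rewrite -[X in is_derive _ _ _ X]add0r; apply: is_deriveD.
have dh' : differentiable h s by apply/derivable1_diffP.
apply: DeriveDef; first by apply/derivable1_diffP/(differentiable_comp dh').
by rewrite (derive_compE _ dh' df) derive_val.
Qed.

Lemma mvt_line f x u (r : R) : 0 < r ->
  (forall s, 0 <= s <= r -> differentiable f (x + s *: u)) ->
  exists2 s, 0 < s < r & f (x + r *: u) - f x = r * 'D_u f (x + s *: u).
Proof.
move=> r0 df.
have dl s : 0 <= s <= r -> is_derive s 1 (fun t : R => f (x + t *: u)) ('D_u f (x + s *: u)).
  by move=> /df; exact: is_derive_line.
have [s||s] := MVT (f := fun t : R => f (x + t *: u))
  (df := fun s => 'D_u f (x + s *: u)) r0.
- by rewrite in_itv /= => /andP[s0 sr]; apply: dl; rewrite !ltW.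
- apply: continuous_in_subspaceT => s; rewrite inE /= in_itv /= => sr.
  by apply/differentiable_continuous/derivable1_diffP; have [] := dl _ sr.
- rewrite in_itv /= => sr; rewrite scale0r addr0 subr0 mulrC => e.
  by exists s.
Qed.

(** The second difference of [f] over the parallelogram spanned by [u] and [v];
    its symmetry in [u] and [v] is the source of the symmetry of second
    derivatives. *)
Definition square_difference f x u v : R :=
  f (x + u + v) - f (x + u) - (f (x + v) - f x).

Lemma square_differenceC f x u v :
  square_difference f x u v = square_difference f x v u.
Proof.
rewrite /square_difference [x + v + u]addrAC !opprB addrACA [RHS]addrACA.
by congr (_ + _); rewrite addrC.
Qed.

(** Two applications of the mean value theorem: first along [u] to
    y |-> f (y + r v) - f y, then along [v] to D_u f. *)
Lemma square_difference_mixed f x u v (r rho : R) U : open U -> Ck 2 U f ->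
  ball x rho `<=` U -> 0 < r -> r * (`|u| + `|v|) < rho ->
  exists2 y, `|x - y| <= r * (`|u| + `|v|) &
    square_difference f x (r *: u) (r *: v) = r * r * 'D_v ('D_u f) y.
Proof.
move=> oU [df ddf] bU r0 rlt.
have near_x (a b : R) : 0 <= a <= r -> 0 <= b <= r ->
    `|x - (x + b *: v + a *: u)| <= r * (`|u| + `|v|).
  move=> /andP[a0 ar] /andP[b0 br].
  rewrite -addrA opprD addNKr normrN (le_trans (ler_normD _ _))// !normrZ !ger0_norm//.
  by rewrite mulrDr addrC lerD// ler_wpM2r.
have inU (a b : R) : 0 <= a <= r -> 0 <= b <= r -> U (x + b *: v + a *: u).
  move=> ha hb; apply: bU; rewrite -ball_normE /=.
  exact: le_lt_trans (near_x _ _ ha hb) rlt.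
have r0r : 0 <= r <= r by rewrite lexx ltW.
have z0r : 0 <= (0 : R) <= r by rewrite lexx ltW.
have inU0 (a : R) : 0 <= a <= r -> U (x + a *: u).
  by move=> ha; have := inU a 0 ha z0r; rewrite scale0r addr0.
pose h y := f (y + r *: v) - f y.
have dsh y : U (y + r *: v) -> differentiable (fun y => f (y + r *: v)) y.
  move=> Uy; apply: (@differentiable_comp _ _ _ _ (fun y => y + r *: v) f).
    by apply: differentiableD => //; exact: differentiable_cst.
  exact: df.
have [|s /andP[s0 sr] es] := @mvt_line h x u r r0.
  move=> s hs; apply: differentiableB; last by apply: df; exact: inU0.
  by apply: dsh; rewrite addrAC; exact: inU.
have hs : 0 <= s <= r by rewrite !ltW.
have [|t /andP[t0 tr] et] := @mvt_line ('D_u f) (x + s *: u) v r r0.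
  by move=> t ht; rewrite addrAC; case: (ddf u) => + _; apply; exact: inU.
exists (x + s *: u + t *: v); first by rewrite addrAC; apply: near_x; rewrite // !ltW.
rewrite -mulrA -et.
have -> : square_difference f x (r *: u) (r *: v) = h (x + r *: u) - h x by [].
rewrite es; congr (_ * _); rewrite /h.
have Us : U (x + s *: u + r *: v) by rewrite addrAC; exact: inU.
rewrite deriveB; [|by apply/diff_derivable/dsh|by apply/diff_derivable/df/inU0].
congr (_ - _).
have dtr : differentiable (fun y => y + r *: v) (x + s *: u).
  by apply: differentiableD => //; exact: differentiable_cst.
rewrite (derive_compE _ dtr (df _ Us)).
have -> : 'D_u ( +%R^~ (r *: v)) (x + s *: u) = u; last by [].
by rewrite (deriveD (f := id) (g := cst _))// derive_id derive_cst addr0.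
Qed.

(** The symmetric second difference over a parallelogram of size [r] is both
    r^2 D_v D_u f and r^2 D_u D_v f, at two points near [x]; both derivatives
    are continuous at [x], and [r] is arbitrarily small. *)
Lemma derive_swap f x u v U : open U -> U x -> Ck 2 U f ->
  'D_v ('D_u f) x = 'D_u ('D_v f) x.
Proof.
move=> oU Ux Cf; case: (Cf) => df ddf.
have [rho /= rho0 bU] : exists2 rho : R, 0 < rho & ball x rho `<=` U.
  by apply/nbhs_ballP/open_nbhs_nbhs.
have cvu : {for x, continuous ('D_v ('D_u f))}.
  by case: (ddf u) => _ /(_ v); apply.
have cuv : {for x, continuous ('D_u ('D_v f))}.
  by case: (ddf v) => _ /(_ u); apply.
apply/eqP; rewrite -subr_eq0 -normr_le0; apply/ler_addgt0Pr => e e0; rewrite add0r.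
have e2 : 0 < e / 2 by rewrite divr_gt0.
move/cvgrPdist_le : cvu => /(_ _ e2)/nbhs_ballP[d1 /= d10 H1].
move/cvgrPdist_le : cuv => /(_ _ e2)/nbhs_ballP[d2 /= d20 H2].
pose d : R := Num.min rho (Num.min d1 d2).
have d0 : 0 < d by rewrite !lt_min rho0 d10.
(* the summand 1 makes [c] positive even if u = v = 0 *)
pose c : R := `|u| + `|v| + 1.
have c0 : 0 < c by rewrite ltr_wpDl// addr_ge0.
pose r : R := d / c.
have r0 : 0 < r by rewrite divr_gt0.
have rd : r * (`|u| + `|v|) < d.
  by rewrite /r mulrAC ltr_pdivrMr// ltr_pM2l// ltrDl.
have [|y1 y1x e1] := square_difference_mixed oU Cf bU r0 (u := u) (v := v).
  by apply: lt_le_trans rd _; rewrite /d ge_min lexx.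
have [|y2 y2x e2'] := square_difference_mixed oU Cf bU r0 (u := v) (v := u).
  by rewrite [`|v| + _]addrC; apply: lt_le_trans rd _; rewrite /d ge_min lexx.
have /H1 h1 : ball x d1 y1.
  rewrite -ball_normE /=; apply: le_lt_trans y1x _; apply: lt_le_trans rd _.
  by rewrite /d !ge_min lexx orbT.
have /H2 h2 : ball x d2 y2.
  rewrite -ball_normE /=; apply: le_lt_trans y2x _; rewrite addrC; apply: lt_le_trans rd _.
  by rewrite /d !ge_min lexx !orbT.
have E12 : 'D_v ('D_u f) y1 = 'D_u ('D_v f) y2.
  have rr0 : r * r != 0 by rewrite mulf_neq0// gt_eqF.
  have e3 := etrans (esym e1) (etrans (square_differenceC f x _ _) e2').
  exact: mulfI rr0 _ _ e3.
move: h1 h2; rewrite E12 [X in _ -> X <= _ -> _]distrC.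
move: ('D_v _ x) ('D_u _ x) ('D_u _ y2) => a b w; clear => aw wb.
by rewrite -(subrKA w) (le_trans (ler_normD _ _))// (splitr e) lerD.
Qed.
End Schwarz.

(** * Flat functions *)

Section Bump.
Context {R : realType}.

(** The functions t^(-k) exp(-1/t), extended by 0 to t <= 0: the derivatives of
    [flat 0] are combinations of them, so the whole family can be shown to be
    smooth at once. *)
Definition flat (k : nat) (t : R) : R :=
  if 0 < t then t^-1 ^+ k * expR (- t^-1) else 0.

Lemma flat_gt0 k t : 0 < t -> 0 < flat k t.
Proof. by move=> t0; rewrite /flat t0 mulr_gt0 ?exprn_gt0 ?invr_gt0 ?expR_gt0. Qed.

Lemma flat_le0 k t : t <= 0 -> flat k t = 0.
Proof. by move=> t0; rewrite /flat ltNge t0. Qed.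

(** From exp s >= s^(k+2) / (k+2)! with s = 1/t. The quadratic bound makes the
    derivative at 0 vanish. *)
Lemma flat_bound k t : `|flat k t| <= (k.+2)`!%:R * t ^+ 2.
Proof.
have [t0|t0] := ltP 0 t; last first.
  by rewrite flat_le0// normr0 mulr_ge0// sqr_ge0.
rewrite ger0_norm; last exact/ltW/flat_gt0.
rewrite /flat t0 expRN -ler_pdivrMr ?exprn_gt0//.
have s0 : 0 < t^-1 by rewrite invr_gt0.
have tE : t ^- 2 = t^-1 ^+ 2 by rewrite exprVn.
rewrite mulrAC tE -exprD addn2 ler_pdivrMr ?expR_gt0// mulrC -ler_pdivrMr; last first.
  by rewrite ltr0n fact_gt0.
by apply: le_trans (expR_ge1Dxn k.+1 (ltW s0)); rewrite lerDr.
Qed.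

Lemma is_derive_flat k (t : R) :
  is_derive t 1 (flat k) (flat k.+2 t - k%:R * flat k.+1 t).
Proof.
have [t0|t0|t0] := ltgtP 0 t.
- have -> : flat k.+2 t - k%:R * flat k.+1 t =
     t^-1 ^+ k *: (expR (- t^-1) * t ^- 2) +
     expR (- t^-1) *: (k%:R * t^-1 ^+ k.-1 *: (- t ^- 2)).
    rewrite /flat t0 /GRing.scale/= -exprVn.
    by case: k => [|k] /=; rewrite ?mul0r ?mulr0 ?mul0r; rewrite ?exprS; ring.
  apply: (@near_eq_is_derive _ _ _ ((fun s : R => s^-1 ^+ k) * (fun s => expR (- s^-1)))%R).
    by near=> s; rewrite fctE /flat ifT//; near: s; exact: lt_nbhsr.
  have dV : is_derive t (1 : R) (fun s : R => s^-1) (- t ^- 2).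
    have := is_deriveV (f := id) (x := t) (lt0r_neq0 t0) (is_derive_id t 1).
    by rewrite /GRing.scale /= mulr1.
  apply: is_deriveM; first by have := is_deriveX k dV; rewrite exprfctE.
  have := @is_derive1_comp _ expR (fun s : R => - s^-1) t (expR (- t^-1)) (t ^- 2) _ _; apply => //.
  by have := is_deriveN dV; rewrite opprK.
- rewrite !flat_le0 ?ltW// mulr0 subr0.
  apply: (@near_eq_is_derive _ _ _ (cst 0)) => //.
  by near=> s; rewrite flat_le0//; apply/ltW; near: s; exact: lt_nbhsl.
- rewrite -t0 !flat_le0// mulr0 subr0.
  (* by flat_bound the difference quotient at 0 is O(h) *)
  suff c0 : h^-1 *: ((flat k \o shift 0) (h *: 1) - flat k 0) @[h --> 0^'] --> (0 : R).
    apply: DeriveDef; first by apply/cvg_ex; exists 0.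
    exact: cvg_lim c0.
  apply/cvgrPdist_le => e e0.
  have F0 : 0 < (k.+2)`!%:R :> R by rewrite ltr0n fact_gt0.
  near=> h.
  have h0 : h != 0 by near: h; exact: nbhs_dnbhs_neq.
  rewrite /= sub0r normrN [flat k 0]flat_le0// subr0 /GRing.scale /= mulr1 addr0 normrM normfV.
  rewrite ler_pdivrMl ?normr_gt0//; apply: le_trans (flat_bound k h) _.
  rewrite -real_normK ?num_real// expr2 mulrCA ler_pM2l ?normr_gt0//.
  rewrite -ler_pdivlMl// mulrC; near: h; apply: dnbhs0_le; exact: divr_gt0.
Unshelve. all: by end_near. Qed.

(** All orders [k] are treated together, because the derivative of
    [flat k \o f] involves [flat k.+1 \o f] and [flat k.+2 \o f]. *)
Lemma Ck_flat (E : normedModType R) j k U (f : E -> R) : open U ->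
  Ck j U f -> Ck j U (fun x => flat k (f x)).
Proof.
move=> oU; have dflat i (t : R) : differentiable (flat i) t.
  by apply/derivable1_diffP; have [] := is_derive_flat i t.
elim: j k => [|j IH] k.
  move=> cf x Ux; apply: (@continuous_comp _ _ _ f (flat k)); first exact: cf.
  exact: differentiable_continuous.
move=> Cf; case: (Cf) => df Hf; split=> [x Ux|v].
  by apply: (@differentiable_comp _ _ _ _ f (flat k)) => //; exact: df.
have IHf i := IH i (CkS Cf).
have := CkM oU (Hf v) (CkB oU (IHf k.+2) (CkM oU (Ck_cst j U (k%:R : R)) (IHf k.+1))).
apply: Ck_ext => // x Ux /=.
rewrite (derive_compE _ (df x Ux) (dflat k (f x))).
rewrite -[X in 'D_X (flat k) _]mulr1 deriveZl//; congr (_ * _).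
by have [_ ->] := is_derive_flat k (f x).
Qed.
End Bump.

(** * Smooth germs on a manifold *)

Section Germs.
Context {R : realType} {n : nat} {M : topologicalType}.
Variable A : atlas R n M.
Implicit Types (f g h : M -> R) (X Y Z : M -> 'rV[R]_n) (p q : M) (i j : idx A).

Local Notation img i := (coord i @` dom i).

Lemma param_img i y : img i y -> dom i (param i y) /\ coord i (param i y) = y.
Proof. by move=> [q dq <-]; rewrite coordK. Qed.

Lemma img_coord i p : dom i p -> img i (coord i p).
Proof. by move=> dp; exists p. Qed.

Lemma near_dom i p : dom i p -> \forall q \near p, dom i q.
Proof. by move=> dp; apply: open_nbhs_nbhs; split=> //; exact: dom_open. Qed.

Lemma near_img i p : dom i p -> \forall y \near coord i p, img i y.
Proof.
by move=> dp; apply: open_nbhs_nbhs; split; [exact: img_open|exact: img_coord].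
Qed.

Lemma near_param i p (P : set M) : dom i p -> (\forall q \near p, P q) ->
  \forall y \near coord i p, P (param i y).
Proof.
move=> dp nP; have := @param_continuous _ _ _ A i _ (img_coord dp).
by rewrite /prop_for /continuous_at coordK// => /(_ P nP).
Qed.

Lemma near_coord i p (P : set 'rV[R]_n) : dom i p ->
  (\forall y \near coord i p, P y) -> \forall q \near p, P (coord i q).
Proof. by move=> dp nP; apply: (coord_continuous dp nP). Qed.

(** Smoothness near [p]. The constructions below are local (coordinate
    functions, quotients), and global smooth maps are those that are smooth
    near every point. *)
Definition smooth_at p f := forall i, dom i p ->
  exists U : set 'rV[R]_n, [/\ open U, U (coord i p), U `<=` img i &
    smooth_on U (f \o param i)].

(** One chart suffices: in any other chart [j] the function is composed with
    the smooth transition map from [j] to [i]. *)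
Lemma smooth_at_chart i p f (U : set 'rV[R]_n) : dom i p -> open U -> U (coord i p) ->
  smooth_on U (f \o param i) -> smooth_at p f.
Proof.
move=> di oU Up sf j dj.
pose W := [set y | img j y /\ dom i (param j y) /\ U (coord i (param j y))]°.
have WW y : W y -> img j y /\ dom i (param j y) /\ U (coord i (param j y)).
  exact: interior_subset.
have oW : open W by exact: open_interior.
exists W; split=> //.
- rewrite /W /interior /=; near=> y; split; last split; near: y.
  + exact: near_img.
  + by apply: (near_param dj); exact: near_dom.
  + apply: (near_param (P := fun q => U (coord i q)) dj); apply: near_coord => //.
    exact: open_nbhs_nbhs.
- by move=> y /WW[].
move=> k; apply: (@Ck_ext _ _ _ k W ((f \o param i) \o (coord i \o param j))) => //.
  by move=> y /WW[_ [diy _]] /=; rewrite coordK.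
apply: (@Ck_comp _ _ _ k W U) => //.
- by move=> y /WW[_ []].
- apply: Ck_sub (@transition_smooth _ _ _ A j i k) => y /WW[/param_img[djy yE] [diy _]].
  by exists (param j y).
Unshelve. all: by end_near. Qed.

(** Being of class C^k is a pointwise condition, so it can be checked on small
    open sets. *)
Lemma smooth_mapP f : smooth_map A f <-> forall p, smooth_at p f.
Proof.
split=> [sf p i di|sf i k].
  by exists (img i); split => //; exact: img_open.
apply: Ck_local => y /param_img[di yE].
have [U [oU Uy _ sU]] := sf _ _ di.
by exists U; [rewrite -yE|exact: sU].
Qed.

Lemma smooth_at_near p f : smooth_at p f -> \forall q \near p, smooth_at q f.
Proof.
move=> sf; pose c := chart_at A p.
have dc : dom c p := chart_atP A p.
have [U [oU Up Ui sU]] := sf c dc.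
near=> q; apply: (@smooth_at_chart c _ _ U) => //; near: q; first exact: near_dom.
by apply: near_coord => //; exact: open_nbhs_nbhs.
Unshelve. all: by end_near. Qed.

Lemma smooth_at_binop (op : (M -> R) -> (M -> R) -> M -> R) p :
  (forall i U f g, open U -> smooth_on U (f \o param i) ->
     smooth_on U (g \o param i) -> smooth_on U (op f g \o param (i : idx A))) ->
  forall f g, smooth_at p f -> smooth_at p g -> smooth_at p (op f g).
Proof.
move=> H f g sf sg i di.
have [U [oU Up Ui sU]] := sf i di; have [W [oW Wp Wi sW]] := sg i di.
exists (U `&` W); split => //; first exact: openI.
  by move=> y [/Ui].
apply: H => //; first exact: openI.
- by move=> k; apply: Ck_sub (sU k) => y [].
- by move=> k; apply: Ck_sub (sW k) => y [].
Qed.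

Lemma smooth_at_cst p (a : R) : smooth_at p (cst a).
Proof.
move=> i di; exists (img i); split=> //; first exact: img_open.
by move=> k; exact: (Ck_cst k _ a).
Qed.

Lemma smooth_atD p f g : smooth_at p f -> smooth_at p g -> smooth_at p (f \+ g).
Proof.
apply: (@smooth_at_binop (fun f g => f \+ g)) => i U f1 g1 oU sf sg k.
exact: (CkD oU (sf k) (sg k)).
Qed.

Lemma smooth_atM p f g : smooth_at p f -> smooth_at p g -> smooth_at p (f \* g).
Proof.
apply: (@smooth_at_binop (fun f g => f \* g)) => i U f1 g1 oU sf sg k.
exact: (CkM oU (sf k) (sg k)).
Qed.

Lemma smooth_at_eq p f g : (\forall q \near p, f q = g q) ->
  smooth_at p f -> smooth_at p g.
Proof.
move=> fg sf i di; have [U [oU Up Ui sU]] := sf i di.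
pose W := (U `&` [set y | f (param i y) = g (param i y)])°.
have WW y : W y -> U y /\ f (param i y) = g (param i y) by exact: interior_subset.
exists W; split.
- exact: open_interior.
- rewrite /W /interior; near=> y; split; near: y; first exact: open_nbhs_nbhs.
  exact: (near_param (P := fun q => f q = g q)).
- by move=> y /WW[/Ui].
- move=> k; apply: Ck_ext (Ck_sub _ (sU k)); first exact: open_interior.
    by move=> y /WW[].
  by move=> y /WW[].
Unshelve. all: by end_near. Qed.

Lemma smooth_atN p f : smooth_at p f -> smooth_at p (fun q => - f q).
Proof.
move=> sf; have := smooth_atM (@smooth_at_cst p (-1)) sf; apply: smooth_at_eq.
by apply: nearW => q /=; rewrite mulN1r.
Qed.

Lemma smooth_atB p f g : smooth_at p f -> smooth_at p g -> smooth_at p (f \- g).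
Proof. by move=> sf sg; apply: smooth_atD => //; exact: smooth_atN. Qed.

Lemma smooth_at_sum (I : Type) (r : seq I) p (F : I -> M -> R) :
  (forall k, smooth_at p (F k)) -> smooth_at p (fun q => \sum_(k <- r) F k q).
Proof.
move=> sF; elim: r => [|k r IH].
  by apply: smooth_at_eq (@smooth_at_cst p (0 : R)); apply: nearW => q; rewrite big_nil.
by apply: smooth_at_eq (smooth_atD (sF k) IH); apply: nearW => q /=; rewrite big_cons.
Qed.

Lemma smooth_at_prod (I : Type) (r : seq I) p (F : I -> M -> R) :
  (forall k, smooth_at p (F k)) -> smooth_at p (fun q => \prod_(k <- r) F k q).
Proof.
move=> sF; elim: r => [|k r IH].
  by apply: smooth_at_eq (@smooth_at_cst p (1 : R)); apply: nearW => q; rewrite big_nil.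
by apply: smooth_at_eq (smooth_atM (sF k) IH); apply: nearW => q /=; rewrite big_cons.
Qed.

Lemma smooth_at_flat k p f : smooth_at p f -> smooth_at p (fun q => flat k (f q)).
Proof.
move=> sf i di; have [U [oU Up Ui sU]] := sf i di.
by exists U; split=> // j; exact: Ck_flat (sU j).
Qed.

Lemma smooth_at_differentiable i p f : dom i p -> smooth_at p f ->
  differentiable (f \o param i) (coord i p).
Proof. by move=> di /(_ i di) [U [oU Up _ /(_ 1) [+ _]]]; exact. Qed.

Lemma smooth_at_neq0 p f : smooth_at p f -> f p != 0 -> \forall q \near p, f q != 0.
Proof.
move=> sf f0; have dc : dom (chart_at A p) p by exact: chart_atP.
have n0 : \forall y \near coord (chart_at A p) p, f (param (chart_at A p) y) != 0.
  have := differentiable_continuous (smooth_at_differentiable dc sf).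
  move=> /(_ [set t | t != 0]); rewrite /= coordK//; apply.
  by apply: open_nbhs_nbhs; split => //; exact: open_neq0.
near=> q; rewrite -[q](@coordK _ _ _ A (chart_at A p)); near: q.
- exact: (near_coord dc n0).
- exact: near_dom.
Unshelve. all: by end_near. Qed.

Lemma smooth_atV p f : smooth_at p f -> f p != 0 -> smooth_at p (fun q => (f q)^-1).
Proof.
move=> sf f0 i di; have [U [oU Up Ui sU]] := sf i di.
pose W := (U `&` [set y | f (param i y) != 0])°.
have WW y : W y -> U y /\ f (param i y) != 0 by exact: interior_subset.
exists W; split.
- exact: open_interior.
- rewrite /W /interior; near=> y; split; near: y; first exact: open_nbhs_nbhs.
  exact: (near_param (P := fun q => f q != 0) di (smooth_at_neq0 sf f0)).
- by move=> y /WW[/Ui].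
- move=> k; apply: CkV; first exact: open_interior.
    by move=> y /WW[].
  by apply: Ck_sub (sU k) => y /WW[].
Unshelve. all: by end_near. Qed.

Definition coord_fun i (k : 'I_n) : M -> R := fun q => coord i q 0 k.

Lemma smooth_at_coord i k p : dom i p -> smooth_at p (coord_fun i k).
Proof.
move=> di; apply: (@smooth_at_chart i p _ (img i)) => //; first exact: img_open.
move=> l; apply: (@Ck_ext _ _ _ l (img i) (fun y : 'rV[R]_n => y 0 k)).
- exact: img_open.
- by move=> y /param_img[_ yE]; rewrite /coord_fun /= yE.
- by move: k; apply/(@Ck_rV _ _ _ l (img i) id); [exact: img_open|exact: Ck_id].
Qed.

End Germs.

(** * Vector fields as derivations and the Lie bracket *)

Section Derivations.
Context {R : realType} {n : nat} {M : topologicalType}.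
Variable A : atlas R n M.
Implicit Types (f g h : M -> R) (X Y Z : M -> 'rV[R]_n) (p q : M) (i j : idx A).

Local Notation img i := (coord i @` dom i).
Local Notation smooth_at := (smooth_at A).
Local Notation chart p := (chart_at A p).

Lemma coord_chart_differentiable i j p : dom i p -> dom j p ->
  differentiable (coord j \o param i) (coord i p).
Proof.
move=> di dj; apply/differentiable_rVP => k.
apply: (@smooth_at_differentiable _ _ _ A i p (coord_fun j k)) => //; exact: smooth_at_coord.
Qed.

Lemma chart_change_near i j p : dom i p -> dom j p ->
  \forall y \near coord i p, dom j (param i y) /\ coord i (param i y) = y.
Proof.
move=> di dj; near=> y; split; near: y.
  by apply: (near_param di); exact: near_dom.
by apply: filterS (near_img di) => y /param_img[].
Unshelve. all: by end_near. Qed.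

Lemma act_coord X i k p : dom i p -> act A X (coord_fun i k) p = act A X (coord i) p 0 k.
Proof.
move=> di; rewrite /act /tder -derive_coord//.
apply: coord_chart_differentiable => //; exact: chart_atP.
Qed.

(** Tangent vectors at [p] are written in the chart selected at [p]; by the
    chain rule their action can be computed in any other chart, provided their
    components there are used. This is what makes derivatives along a vector
    field comparable at nearby points, whose selected charts may differ. *)
Lemma act_chartE X i p f : dom i p -> smooth_at p f ->
  act A X f p = 'D_(act A X (coord i) p) (f \o param i) (coord i p).
Proof.
move=> di sf; have dc : dom (chart p) p by exact: chart_atP.
rewrite {1}/act /tder.
transitivity ('D_(X p) ((f \o param i) \o (coord i \o param (chart p))) (coord (chart p) p)).
  apply: near_eq_derive; apply: filterS (chart_change_near dc di) => y [diy _] /=.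
  by rewrite coordK.
rewrite derive_compE; last 2 first.
- exact: coord_chart_differentiable.
- by rewrite /= coordK//; exact: smooth_at_differentiable.
by rewrite /= coordK.
Qed.

(** In the selected chart the transition map is the identity. *)
Lemma act_chart_at X p : act A X (coord (chart p)) p = X p.
Proof.
have dc : dom (chart p) p by exact: chart_atP.
rewrite /act /tder -[RHS](derive_id (coord (chart p) p)).
by apply: near_eq_derive; apply: filterS (chart_change_near dc dc) => y [_].
Qed.

Lemma act_sumE X i p f : dom i p -> smooth_at p f -> act A X f p =
  \sum_k act A X (coord_fun i k) p * 'D_('e_k) (f \o param i) (coord i p).
Proof.
move=> di sf; rewrite (act_chartE _ di sf) derive_rV; last exact: smooth_at_differentiable.
by apply: eq_bigr => k _; rewrite act_coord.
Qed.

Lemma smooth_at_partial i k p f : dom i p -> smooth_at p f ->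
  smooth_at p (fun q => 'D_('e_k) (f \o param i) (coord i q)).
Proof.
move=> di sf; have [U [oU Up Ui sU]] := sf i di.
apply: (smooth_at_chart di oU Up) => l; have [_ /(_ 'e_k)] := sU l.+1.
by apply: Ck_ext => // y /Ui/param_img[_ yE] /=; rewrite yE.
Qed.

Lemma smooth_vfP X : smooth_vf A X <->
  forall i k p, dom i p -> smooth_at p (act A X (coord_fun i k)).
Proof.
split=> [sX i k p di|sX i l].
  apply: (@smooth_at_eq _ _ _ _ _ (fun q => act A X (coord i) q 0 k)).
    by apply: filterS (near_dom di) => q dq; rewrite act_coord.
  apply: (@smooth_at_chart _ _ _ _ i p _ (img i)) => //; first exact: img_open.
  move=> l; have := sX i l; rewrite Ck_rV; last exact: img_open.
  exact.
apply/Ck_rV; first exact: img_open.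
move=> k; apply: Ck_local => y yi; have [dy yE] := param_img yi.
have [U [oU Uy Ui sU]] := sX i k _ dy i dy.
exists U; first by rewrite -yE.
by apply: Ck_ext (sU l) => // z /Ui/param_img[dz _] /=; rewrite act_coord.
Qed.

Lemma smooth_at_act X p f : smooth_vf A X -> smooth_at p f -> smooth_at p (act A X f).
Proof.
move=> /smooth_vfP sX sf; have dc : dom (chart p) p by exact: chart_atP.
have : smooth_at p (fun q => \sum_k (act A X (coord_fun (chart p) k) \*
   (fun q => 'D_('e_k) (f \o param (chart p)) (coord (chart p) q))) q).
  apply: smooth_at_sum => k; apply: smooth_atM; first exact: sX.
  exact: smooth_at_partial.
apply: smooth_at_eq; near=> q; rewrite (@act_sumE X (chart p))//; near: q.
  exact: near_dom.
exact: smooth_at_near.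
Unshelve. all: by end_near. Qed.

Lemma act_eq X p f g : (\forall q \near p, f q = g q) -> act A X f p = act A X g p.
Proof.
move=> fg; apply: near_eq_derive.
by apply: (near_param (P := fun q => f q = g q)) => //; exact: chart_atP.
Qed.

Section Pointwise.
Variables (p : M) (X : M -> 'rV[R]_n) (f g : M -> R).
Hypotheses (sf : smooth_at p f) (sg : smooth_at p g).

Let df : differentiable (f \o param (chart p)) (coord (chart p) p).
Proof. by apply: smooth_at_differentiable => //; exact: chart_atP. Qed.
Let dg : differentiable (g \o param (chart p)) (coord (chart p) p).
Proof. by apply: smooth_at_differentiable => //; exact: chart_atP. Qed.

Lemma actD : act A X (f \+ g) p = act A X f p + act A X g p.
Proof. by rewrite /act /tder -deriveD//; exact: diff_derivable. Qed.

Lemma actM : act A X (f \* g) p = f p * act A X g p + g p * act A X f p.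
Proof.
rewrite /act /tder (deriveM (f := f \o _) (g := g \o _))//; last 2 first.
- exact: diff_derivable.
- exact: diff_derivable.
by rewrite /= coordK//; exact: chart_atP.
Qed.

Lemma act_addl Y : act A (X + Y) f p = act A X f p + act A Y f p.
Proof. by rewrite /act /tder deriveDl. Qed.

Lemma act_scalel (a : M -> R) : act A (fun q => a q *: X q) f p = a p * act A X f p.
Proof. by rewrite /act /tder deriveZl. Qed.
End Pointwise.

Lemma act_cst X p (a : R) : act A X (cst a) p = 0.
Proof. by rewrite /act /tder (_ : cst a \o _ = cst a)// derive_cst. Qed.

Lemma act0 p f : act A 0 f p = 0.
Proof. by rewrite /act /tder derive0. Qed.

Lemma actN X p f : smooth_at p f -> act A X (fun q => - f q) p = - act A X f p.
Proof.
move=> sf; rewrite -[RHS]add0r -(act_cst X p (-1)).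
transitivity (act A X (cst (-1) \* f) p).
  by apply: act_eq; apply: nearW => q /=; rewrite mulN1r.
by rewrite actM ?act_cst//= ?mulr0 ?addr0 ?mulN1r ?add0r//; exact: smooth_at_cst.
Qed.

Lemma actB X p f g : smooth_at p f -> smooth_at p g ->
  act A X (f \- g) p = act A X f p - act A X g p.
Proof.
move=> sf sg; rewrite -actN//.
by rewrite -(actD _ sf (smooth_atN sg)).
Qed.

Lemma act_sum (I : Type) (r : seq I) X p (F : I -> M -> R) :
  (forall k, smooth_at p (F k)) ->
  act A X (fun q => \sum_(k <- r) F k q) p = \sum_(k <- r) act A X (F k) p.
Proof.
move=> sF; elim: r => [|k r IH].
  rewrite big_nil -[RHS](act_cst X p 0); apply: act_eq; apply: nearW => q; by rewrite big_nil.
rewrite big_cons -IH -actD//; last exact: smooth_at_sum.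
by apply: act_eq; apply: nearW => q; rewrite big_cons.
Qed.

Lemma smooth_vfD X Y : smooth_vf A X -> smooth_vf A Y -> smooth_vf A (X + Y).
Proof.
move=> /smooth_vfP sX /smooth_vfP sY; apply/smooth_vfP => i k p di.
apply: smooth_at_eq (smooth_atD (sX i k p di) (sY i k p di)).
by apply: filterS (near_dom di) => q dq; rewrite act_addl//; exact: smooth_at_coord.
Qed.

Lemma smooth_vfZ f X : smooth_map A f -> smooth_vf A X -> smooth_vf A (fun q => f q *: X q).
Proof.
move=> /smooth_mapP sf /smooth_vfP sX; apply/smooth_vfP => i k p di.
apply: smooth_at_eq (smooth_atM (sf p) (sX i k p di)).
by apply: filterS (near_dom di) => q dq; rewrite act_scalel//; exact: smooth_at_coord.
Qed.

Lemma smooth_vf0 : smooth_vf A (fun=> 0).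
Proof.
apply/smooth_vfP => i k p di; apply: smooth_at_eq (@smooth_at_cst _ _ _ A p 0).
by apply: nearW => q; rewrite /act /tder derive0.
Qed.

(** The components of the Lie bracket at [p], in the chart selected at [p], are
    the commutators applied to the coordinate functions of that chart. *)
Definition bracket X Y : M -> 'rV[R]_n := fun p =>
  \row_k (act A X (act A Y (coord_fun (chart p) k)) p
          - act A Y (act A X (coord_fun (chart p) k)) p).

(** In a chart, XYf is the sum of the terms X(Y^k) D_k f and of
    X^l Y^k D_l D_k f. The second part is symmetric in [X] and [Y], because
    partial derivatives commute, and disappears from the commutator. *)
Lemma bracketP X Y p f : smooth_vf A X -> smooth_vf A Y -> smooth_at p f ->
  act A (bracket X Y) f p = act A X (act A Y f) p - act A Y (act A X f) p.
Proof.
move=> sX sY sf; have dc : dom (chart p) p by exact: chart_atP.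
set c := chart p.
pose D (k : 'I_n) (q : M) : R := 'D_('e_k) (f \o param c) (coord c q).
have sD k : smooth_at p (D k) by exact: smooth_at_partial.
have sC Z k : smooth_vf A Z -> smooth_at p (act A Z (coord_fun c k)).
  by move=> /smooth_vfP; apply.
have cV Z k : act A Z (coord_fun c k) p = Z p 0 k by rewrite act_coord// act_chart_at.
pose H (l k : 'I_n) : R := 'D_('e_l) ('D_('e_k) (f \o param c)) (coord c p).
have HC l k : H l k = H k l.
  by have [U [oU Up Ui sU]] := sf c dc; exact: derive_swap oU Up (sU 2).
have DH l k : 'D_('e_l) (D k \o param c) (coord c p) = H l k.
  apply: near_eq_derive; apply: filterS (near_img dc) => y /param_img[_ yE].
  by rewrite /D /= yE.
pose S (V W : M -> 'rV[R]_n) : R := \sum_k \sum_l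
  V p 0 l * W p 0 k * H l k.
have sDD V W : smooth_vf A V -> smooth_vf A W -> act A V (act A W f) p =
   (\sum_k act A V (act A W (coord_fun c k)) p * D k p) + S V W.
  move=> sV sW.
  transitivity (act A V (fun q => \sum_k (act A W (coord_fun c k) \* D k) q) p).
    apply: act_eq; near=> q; rewrite (@act_sumE _ c)//; near: q; first exact: near_dom.
    exact: smooth_at_near.
  rewrite act_sum; last by move=> k; apply: smooth_atM => //; exact: sC.
  rewrite -big_split; apply: eq_bigr => k _ /=.
  rewrite actM//; last exact: sC.
  rewrite [LHS]addrC; congr (_ + _); first exact: mulrC.
  rewrite (@act_sumE _ c _ (D k))// mulr_sumr; apply: eq_bigr => l _.
  by rewrite !cV DH mulrCA mulrA.
have SC : S X Y = S Y X.
  rewrite /S exchange_big; apply: eq_bigr => k _; apply: eq_bigr => l _.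
  by rewrite HC [X p 0 _ * _]mulrC.
have cancel (a b s : R) : (a + s) - (b + s) = a - b by ring.
rewrite (sDD X Y sX sY) (sDD Y X sY sX) SC cancel -sumrB.
rewrite (act_sumE _ dc sf); apply: eq_bigr => k _.
by rewrite cV mxE mulrBl.
Unshelve. all: by end_near. Qed.

Lemma smooth_bracket X Y : smooth_vf A X -> smooth_vf A Y -> smooth_vf A (bracket X Y).
Proof.
move=> sX sY; apply/smooth_vfP => i k p di.
have sc : smooth_at p (coord_fun i k) by exact: smooth_at_coord.
have := smooth_atB (smooth_at_act sX (smooth_at_act sY sc))
  (smooth_at_act sY (smooth_at_act sX sc)).
apply: smooth_at_eq; near=> q; rewrite bracketP//; near: q; exact: smooth_at_near.
Unshelve. all: by end_near. Qed.

(** [bracket] is a witness that a bracket exists, so the chosen one has the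
    defining property; [vf_eq_act] below gives its uniqueness. *)
Lemma lieP X Y : smooth_vf A X -> smooth_vf A Y -> smooth_vf A (lie A X Y) /\
  forall f, smooth_map A f ->
    act A (lie A X Y) f = act A X (act A Y f) - act A Y (act A X f).
Proof.
move=> sX sY; pose P := [set Z | smooth_vf A Z /\ forall f, smooth_map A f ->
  act A Z f = act A X (act A Y f) - act A Y (act A X f)].
suff [Z PZ] : exists Z, P Z by exact: (xgetPex (fun=> 0) (ex_intro _ Z PZ)).
exists (bracket X Y); split=> [|f /smooth_mapP sf]; first exact: smooth_bracket.
by apply/funext => p; rewrite bracketP.
Qed.
End Derivations.

(** * Cutoff functions and tensoriality *)

Section Cutoff.
Context {R : realType} {n : nat} {M : topologicalType}.
Variable A : atlas R n M.
Hypothesis hausM : hausdorff_space M.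
Implicit Types (f g h : M -> R) (X Y Z : M -> 'rV[R]_n) (p q : M) (i j : idx A).

Local Notation img i := (coord i @` dom i).
Local Notation smooth_at := (smooth_at A).
Local Notation chart p := (chart_at A p).

(** A function equal to 1 at [p] that vanishes near every point outside the
    chart selected at [p]: multiplying by it extends by zero any smooth object
    of that chart to the whole manifold. *)
Definition cutoff p (psi : M -> R) : Prop := [/\ smooth_map A psi, psi p = 1 &
  forall q, ~ dom (chart p) q -> \forall q' \near q, psi q' = 0].

Lemma cutoff_out p psi q : cutoff p psi -> ~ dom (chart p) q -> psi q = 0.
Proof. by move=> [_ _ H] /H/nbhs_singleton. Qed.

(** In coordinates, a product of one-variable bumps supported in a closed cube.
    The image of this cube in the manifold is compact, hence closed because
    the space is Hausdorff, so that the extension by zero is smooth outside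
    the chart. *)
Lemma exists_cutoff p : exists psi, cutoff p psi.
Proof.
set c := chart p; have dc : dom c p by exact: chart_atP.
set x := coord c p.
have [r /= r0 bU] : exists2 r : R, 0 < r & ball x r `<=` img c.
  by apply/nbhs_ballP/near_img.
pose r2 := r / 2.
have r20 : 0 < r2 by rewrite divr_gt0.
pose K0 := [set y : 'rV[R]_n | forall k, `[x 0 k - r2, x 0 k + r2]%classic (y 0 k)].
have K0c : compact K0.
  apply: (@rV_compact _ _ (fun k => `[x 0 k - r2, x 0 k + r2]%classic)) => k.
  exact: segment_compact.
have K0i : K0 `<=` img c.
  move=> y Ky; apply: bU; split=> // i k; rewrite (ord1 i).
  have := Ky k; rewrite /= in_itv /= -ler_distlC => h.
  rewrite -ball_normE /=; apply: le_lt_trans h _.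
  by rewrite /r2 ltr_pdivrMr// mulr_natr mulr2n ltrDr.
pose K := param c @` K0.
have Kcl : closed K.
  apply: compact_closed => //; apply: continuous_compact => //.
  apply: continuous_in_subspaceT => y; rewrite inE => /K0i yi.
  exact: param_continuous.
have Kd : K `<=` dom c by move=> _ [y /K0i/param_img[dy _] <-].
pose b (k : 'I_n) : M -> R := fun q => flat 0 (r2 ^+ 2 - (coord c q 0 k - x 0 k) ^+ 2).
pose B : M -> R := fun q => \prod_k b k q.
have Bp : B p != 0.
  apply/prodf_neq0 => k _.
  by rewrite /b subrr expr0n subr0 gt_eqF// flat_gt0// exprn_gt0.
have BK q : dom c q -> B q != 0 -> K q.
  move=> dq B0; exists (coord c q); last exact: coordK.
  move=> k /=; rewrite in_itv /= -ler_distlC.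
  have : b k q != 0 by move/prodf_neq0: B0; apply.
  rewrite leNgt; apply: contra => lt; rewrite /b flat_le0//.
  rewrite subr_le0 -(real_normK (num_real (_ - _))) distrC.
  by rewrite lerXn2r ?nnegrE ?normr_ge0 ?(ltW r20) ?(ltW lt).
have sB q : dom c q -> smooth_at q B.
  move=> dq; apply: smooth_at_prod => k; apply: smooth_at_flat.
  have sd : smooth_at q (fun q => coord_fun c k q - x 0 k).
    by apply: smooth_atB; [exact: smooth_at_coord|exact: (@smooth_at_cst _ _ _ _ _ (x 0 k))].
  have := smooth_atB (@smooth_at_cst _ _ _ A q (r2 ^+ 2)) (smooth_atM sd sd).
  by apply: smooth_at_eq; apply: nearW => q' /=; rewrite -expr2.
pose psi q := if `[< dom c q >] then B q / B p else 0.
have psiK q : ~ K q -> psi q = 0.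
  move=> nK; rewrite /psi; case: asboolP => // dq.
  have [->|B0] := eqVneq (B q) 0; first by rewrite mul0r.
  by case: nK; exact: BK.
have psi0 q : ~ dom c q -> \forall q' \near q, psi q' = 0.
  move=> nd; have : \forall q' \near q, (~` K) q'.
    apply: open_nbhs_nbhs; split; first exact: closed_openC.
    by move=> /Kd.
  by apply: filterS => q'; exact: psiK.
exists psi; split => //.
- apply/smooth_mapP => q; have [dq|nd] := pselect (dom c q); last first.
    by apply: smooth_at_eq (@smooth_at_cst _ _ _ A q 0); apply: filterS (psi0 _ nd) => q' ->.
  have := smooth_atM (sB q dq) (@smooth_at_cst _ _ _ A q (B p)^-1).
  apply: smooth_at_eq; apply: filterS (near_dom dq) => q' dq'.
  by rewrite /psi asboolT.
- by rewrite /psi asboolT// divff.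
Qed.

Section FixedCutoff.
Variables (p : M) (psi : M -> R).
Hypothesis cpsi : cutoff p psi.
Let c := chart p.
Let dc : dom c p. Proof. exact: chart_atP. Qed.

Lemma cutoff_smooth h : (forall q, dom c q -> smooth_at q h) -> smooth_map A (psi \* h).
Proof.
have [/smooth_mapP spsi _ psi0] := cpsi.
move=> sh; apply/smooth_mapP => q; have [dq|nd] := pselect (dom c q).
  by apply: smooth_atM => //; exact: sh.
apply: smooth_at_eq (@smooth_at_cst _ _ _ A q 0); apply: filterS (psi0 _ nd) => q' /= ->.
by rewrite mul0r.
Qed.

(** The coordinate vector fields of the chart selected at [p], each value being
    expressed in the chart selected at the point where it is taken. *)
Definition coord_field (k : 'I_n) : M -> 'rV[R]_n := fun q =>
  'D_('e_k) (coord (chart q) \o param c) (coord c q).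

Lemma act_coord_field k q f : dom c q -> smooth_at q f ->
  act A (coord_field k) f q = 'D_('e_k) (f \o param c) (coord c q).
Proof.
move=> dq sf; have dcq : dom (chart q) q by exact: chart_atP.
rewrite /act /tder /coord_field.
transitivity ('D_('e_k) ((f \o param (chart q)) \o (coord (chart q) \o param c)) (coord c q)).
  rewrite derive_compE /= ?coordK//; first exact: coord_chart_differentiable.
  exact: smooth_at_differentiable.
apply: near_eq_derive; apply: filterS (chart_change_near dq dcq) => y [diy _] /=.
by rewrite coordK.
Qed.

Lemma coord_field_at k : coord_field k p = 'e_k.
Proof.
rewrite /coord_field -[RHS](derive_id (coord c p)).
by apply: near_eq_derive; apply: filterS (chart_change_near dc dc) => y [_].
Qed.

Lemma smooth_cutoff_field k : smooth_vf A (fun q => psi q *: coord_field k q).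
Proof.
have [/smooth_mapP spsi _ psi0] := cpsi.
apply/smooth_vfP => i l q di; have [dq|nd] := pselect (dom c q).
  have := smooth_atM (spsi q) (smooth_at_partial k dq (smooth_at_coord l di)).
  apply: smooth_at_eq; near=> q'.
  have di' : dom i q' by near: q'; exact: near_dom.
  rewrite act_scalel; last exact: smooth_at_coord.
  rewrite act_coord_field//; last exact: smooth_at_coord.
  by near: q'; exact: near_dom.
apply: smooth_at_eq (@smooth_at_cst _ _ _ A q 0); apply: filterS (psi0 _ nd) => q' e.
by rewrite /act /tder e scale0r derive0.
Unshelve. all: by end_near. Qed.

Lemma coord_field_decomp X q : dom c q ->
  X q = \sum_k act A X (coord_fun c k) q *: coord_field k q.
Proof.
move=> dq; have dcq : dom (chart q) q by exact: chart_atP.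
apply/rowP => l; rewrite -[X q](act_chart_at A) -act_coord//.
rewrite (act_sumE _ dq (smooth_at_coord l dcq)) summxE.
apply: eq_bigr => k _; rewrite mxE; congr (_ * _).
rewrite /coord_field -derive_coord//; exact: coord_chart_differentiable.
Qed.

(** Multiplying by psi^2 leaves one factor psi for the component functions and
    one for the coordinate fields, so that both become global. *)
Lemma cutoff_decomp X : (fun q => (psi \* psi) q *: X q) =
  \sum_k (fun q => (psi \* act A X (coord_fun c k)) q *: (psi q *: coord_field k q)).
Proof.
apply/funext => q; rewrite fct_sumE.
have [dq|nd] := pselect (dom c q); last first.
  rewrite /= (cutoff_out cpsi nd) !mul0r scale0r big1// => k _.
  by rewrite mul0r scale0r.
rewrite {1}(coord_field_decomp X dq) scaler_sumr; apply: eq_bigr => k _ /=.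
by rewrite !scalerA mulrAC.
Qed.

Lemma smooth_cutoff_comp X k : smooth_vf A X ->
  smooth_map A (psi \* act A X (coord_fun c k)).
Proof.
move=> sX; apply: cutoff_smooth => q dq; apply: smooth_at_act => //.
exact: smooth_at_coord.
Qed.

End FixedCutoff.

Lemma smooth_vf_sum (I : Type) (r : seq I) (F : I -> M -> 'rV[R]_n) :
  (forall k, smooth_vf A (F k)) -> smooth_vf A (\sum_(k <- r) F k).
Proof.
move=> sF; elim: r => [|k r IH]; first by rewrite big_nil; exact: smooth_vf0.
by rewrite big_cons; apply: (smooth_vfD (sF k) IH).
Qed.

Lemma smooth_map_cst (a : R) : smooth_map A (cst a : M -> R).
Proof. by apply/smooth_mapP => p; exact: smooth_at_cst. Qed.

Lemma extendP p v : smooth_vf A (extend A p v) /\ extend A p v p = v.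
Proof.
pose P := [set X | smooth_vf A X /\ X p = v].
suff [Z PZ] : exists Z, P Z by exact: (xgetPex (fun=> 0) (ex_intro _ Z PZ)).
have [psi cpsi] := exists_cutoff p.
exists (\sum_k (fun q => v 0 k *: (psi q *: coord_field p k q))); split.
  apply: smooth_vf_sum => k.
  by apply: (smooth_vfZ (smooth_map_cst (v 0 k))); exact: smooth_cutoff_field.
rewrite fct_sumE [RHS]row_sum_delta; apply: eq_bigr => k _.
by have [_ -> _] := cpsi; rewrite scale1r coord_field_at.
Qed.

(** The action on psi and on psi times a coordinate function determines the
    corresponding component at [p], by the Leibniz rule. *)
Lemma vf_eq_act X Y : (forall f, smooth_map A f -> act A X f = act A Y f) -> X = Y.
Proof.
move=> XY; apply/funext => p; have [psi cpsi] := exists_cutoff p.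
have dc : dom (chart p) p by exact: chart_atP.
have [spsi psi1 _] := cpsi; move/smooth_mapP : (spsi) => spsi'.
have E Z k : Z p 0 k = act A Z (psi \* coord_fun (chart p) k) p -
   coord_fun (chart p) k p * act A Z psi p.
  have sc : smooth_at p (coord_fun (chart p) k) by exact: smooth_at_coord.
  by rewrite actM// psi1 mul1r addrK act_coord// act_chart_at.
apply/rowP => k; rewrite (E X) (E Y) !XY//.
by apply: (cutoff_smooth cpsi) => q dq; exact: smooth_at_coord.
Qed.

(** An operator that is linear over smooth functions depends only on the value
    of the field at the point: by [cutoff_decomp] it is determined by its
    values at the fields psi * d_k and by the components X^k(p). *)
Lemma tensorial (V : lmodType R) p (T : (M -> 'rV[R]_n) -> V) :
  (forall X Y, smooth_vf A X -> smooth_vf A Y -> T (X + Y) = T X + T Y) ->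
  (forall f X, smooth_map A f -> smooth_vf A X -> T (fun q => f q *: X q) = f p *: T X) ->
  forall X Y, smooth_vf A X -> smooth_vf A Y -> X p = Y p -> T X = T Y.
Proof.
move=> TD TZ; have [psi cpsi] := exists_cutoff p; have [spsi psi1 _] := cpsi.
have dc : dom (chart p) p by exact: chart_atP.
have T0 : T 0 = 0.
  have sv0 : smooth_vf A (0 : M -> 'rV[R]_n) by exact: smooth_vf0.
  have e := TZ (cst 0) 0 (smooth_map_cst 0) sv0.
  have -> : (0 : M -> 'rV[R]_n) = (fun q => cst 0 q *: (0 : M -> 'rV[R]_n) q).
    by apply/funext => q; rewrite /cst scale0r.
  by rewrite e /cst scale0r.
suff E X : smooth_vf A X -> T X = \sum_k X p 0 k *: T (fun q => psi q *: coord_field p k q).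
  by move=> X Y sX sY XY; rewrite E// [RHS]E// XY.
move=> sX; have sE k := smooth_cutoff_field cpsi k.
have spp : smooth_map A (psi \* psi).
  by move/smooth_mapP : spsi => spsi; apply/smooth_mapP => q; exact: smooth_atM.
have := TZ _ _ spp sX; rewrite /= psi1 mul1r scale1r => <-.
rewrite -[X in T X]/(fun q => (psi \* psi) q *: X q) (cutoff_decomp cpsi).
have sS k := smooth_vfZ (smooth_cutoff_comp cpsi k sX) (sE k).
transitivity (\sum_k T (fun q =>
  (psi \* act A X (coord_fun (chart p) k)) q *: (psi q *: coord_field p k q))).
  elim: (index_enum _) => [|k r IH]; first by rewrite !big_nil.
  by rewrite !big_cons (TD _ _ (sS k) (smooth_vf_sum r sS)) IH.
apply: eq_bigr => k _; rewrite (TZ _ _ (smooth_cutoff_comp cpsi k sX) (sE k)).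
by rewrite /= psi1 mul1r act_coord// act_chart_at.
Qed.

End Cutoff.

(** * The curvature of the Levi-Civita connection *)

Section ModuleIdentities.
Context {R : pzRingType} {V : lmodType R}.
Implicit Types (a b c d l z : V) (x y f : R).

Lemma curv_antisym_id a b c : b - a - - c = - (a - b - c).
Proof. by rewrite opprK !opprB addrC. Qed.

Lemma curv_add_id a a' b b' c c' :
  a + a' - (b + b') - (c + c') = (a - b - c) + (a' - b' - c').
Proof. by rewrite !opprD (AC (2*2*2) ((1*3*5)*(2*4*6))). Qed.

Lemma lie_add_id a a' b b' : a + a' - (b + b') = (a - b) + (a' - b').
Proof. by rewrite opprD addrACA. Qed.

Lemma lie_scale_id f x a b c : f *: a - (x *: c + f *: b) = f *: (a - b) - x *: c.
Proof. by rewrite scalerBr opprD (AC (1*2) (1*3*2)). Qed.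

Lemma curv_scale_id f x a b c d :
  f *: a - (x *: c + f *: b) - (f *: d - x *: c) = f *: (a - b - d).
Proof. by rewrite lie_scale_id opprB addrA subrK -scalerBr. Qed.

Lemma curv_leibniz_id f x y xy yx a b c dx dy z :
  xy *: z + y *: dx + (x *: dy + f *: a) - (yx *: z + x *: dy + (y *: dx + f *: b))
    - ((xy - yx) *: z + f *: c) = f *: (a - b - c) :> V.
Proof.
rewrite !scalerBr scalerBl !opprD opprK.
rewrite (AC (2*2*(2*2)*(2*1)) ((1*9)*(2*7)*(3*6)*(5*10)*(4*8*11))) /=.
by rewrite !subrr addNr !add0r.
Qed.

Lemma bianchi_id a1 a2 b1 b2 c1 c2 l1 l2 l3 :
  (a1 - a2 - l1) + (b1 - b2 - l2) + (c1 - c2 - l3) =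
  (a1 - c2 - l2) + (b1 - a2 - l3) + (c1 - b2 - l1).
Proof. by rewrite (AC (3*3*3) ((1*8*6)*(4*2*9)*(7*5*3))). Qed.

End ModuleIdentities.

(** Among the four cyclic identities, the difference between the sum of the
    first two and the sum of the last two is 2 D u v w z - 2 D w z u v. *)
Lemma pair_symmetry (R : realFieldType) (V : Type) (D : V -> V -> V -> V -> R) :
  (forall a b c d, D a b c d = - D b a c d) ->
  (forall a b c d, D a b c d = - D a b d c) ->
  (forall a b c d, D a b c d + D b c a d + D c a b d = 0) ->
  forall u v w z, D u v w z = D w z u v.
Proof.
move=> S T B u v w z.
have b1 : D u v w z + D v w u z - D u w v z = 0 by rewrite -(S w u) B.
have b2 : - D v w u z - D w z u v + D v z u w = 0.
  by rewrite -(T v w) -(T w z) (T v z) -(S z v) B.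
have b3 : D w z u v + D u z v w - D u w v z = 0.
  by rewrite (T u z) -(S z u) -(T u w) B.
have b4 : - D u z v w - D u v w z + D v z u w = 0.
  by rewrite -(S z u) -(T u v) B.
lra.
Qed.

Section LeviCivita.
(* only the characteristic properties of these operations are used below *)
Opaque Defs.lie Defs.act Defs.smooth_vf Defs.smooth_map.
Context {R : realType} {n : nat} {M : topologicalType}.
Variable A : atlas R n M.
Hypothesis hausM : hausdorff_space M.
Variables (g : M -> 'rV[R]_n -> 'rV[R]_n -> R)
  (nabla : (M -> 'rV[R]_n) -> (M -> 'rV[R]_n) -> M -> 'rV[R]_n).
Hypothesis rg : riemannian A g.
Hypothesis lc : levi_civita A g nabla.
Implicit Types (f : M -> R) (X Y Z W : M -> 'rV[R]_n) (p q : M) (u v w z : 'rV[R]_n).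

Local Notation act := (act A).
Local Notation lie := (lie A).
Local Notation curv := (curv A nabla).
Local Notation curv_at := (curv_at A nabla).
Local Notation smooth_vf := (smooth_vf A).
Local Notation smooth_map := (smooth_map A).

Lemma metricC p u v : g p u v = g p v u. Proof. by case: rg. Qed.
Lemma metricDr p u v w : g p u (v + w) = g p u v + g p u w.
Proof. by have [/(_ p u 1 v w)] := rg; rewrite /= scale1r mul1r. Qed.
Lemma metricZr p u a v : g p u (a *: v) = a * g p u v.
Proof.
have [gs _ _ _] := rg; have g0 : g p u 0 = 0.
  by have /= := gs p u (-1) 0 0; rewrite scaler0 addr0 mulN1r addNr.
by have /= := gs p u a v 0; rewrite !addr0 g0 addr0.
Qed.
Lemma metricNr p u v : g p u (- v) = - g p u v.
Proof. by rewrite -scaleN1r metricZr mulN1r. Qed.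
Lemma metricDl p u v w : g p (v + w) u = g p v u + g p w u.
Proof. by rewrite metricC metricDr !(metricC p u). Qed.
Lemma metricZl p u a v : g p (a *: v) u = a * g p v u.
Proof. by rewrite metricC metricZr (metricC p u). Qed.
Lemma metricNl p u v : g p (- v) u = - g p v u.
Proof. by rewrite metricC metricNr (metricC p u). Qed.
Lemma metric_smooth X Y : smooth_vf X -> smooth_vf Y -> smooth_map (fun p => g p (X p) (Y p)).
Proof. by have [_ _ _] := rg; apply. Qed.

Lemma smooth_map_act X f : smooth_vf X -> smooth_map f -> smooth_map (act X f).
Proof. by move=> sX /smooth_mapP sf; apply/smooth_mapP => p; exact: smooth_at_act. Qed.

Lemma smooth_lie X Y : smooth_vf X -> smooth_vf Y -> smooth_vf (lie X Y).
Proof. by move=> sX sY; have [] := lieP sX sY. Qed.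

Lemma act_lie X Y f p : smooth_vf X -> smooth_vf Y -> smooth_map f ->
  act (lie X Y) f p = act X (act Y f) p - act Y (act X f) p.
Proof. by move=> sX sY sf; have [_ ->] := lieP sX sY. Qed.

Lemma smooth_vfN X : smooth_vf X -> smooth_vf (- X).
Proof.
move=> sX; rewrite (_ : - X = fun q => cst (-1) q *: X q); last first.
  by apply/funext => q; rewrite /cst scaleN1r.
by apply: smooth_vfZ => //; exact: smooth_map_cst.
Qed.

Lemma smooth_vfB X Y : smooth_vf X -> smooth_vf Y -> smooth_vf (X - Y).
Proof. by move=> sX sY; exact: (smooth_vfD sX (smooth_vfN sY)). Qed.

Lemma nablaNl X Z : smooth_vf X -> smooth_vf Z -> nabla (- X) Z = - nabla X Z.
Proof.
move=> sX sZ; rewrite (_ : - X = fun q => cst (-1) q *: X q); last first.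
  by apply/funext => q; rewrite /cst scaleN1r.
rewrite (lc_scalel lc (@smooth_map_cst _ _ _ A (-1)) sX sZ).
by apply/funext => q; rewrite /cst scaleN1r.
Qed.

Lemma nablaNr X Z : smooth_vf X -> smooth_vf Z -> nabla X (- Z) = - nabla X Z.
Proof.
move=> sX sZ; rewrite (_ : - Z = fun q => cst (-1) q *: Z q); last first.
  by apply/funext => q; rewrite /cst scaleN1r.
rewrite (lc_leibniz lc (@smooth_map_cst _ _ _ A (-1)) sX sZ).
by apply/funext => q; rewrite act_cst scale0r add0r /cst scaleN1r.
Qed.

Lemma nablaBl X Y Z : smooth_vf X -> smooth_vf Y -> smooth_vf Z ->
  nabla (X - Y) Z = nabla X Z - nabla Y Z.
Proof. by move=> sX sY sZ; rewrite (lc_addl lc sX (smooth_vfN sY) sZ) nablaNl. Qed.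

Lemma nablaBr X Y Z : smooth_vf X -> smooth_vf Y -> smooth_vf Z ->
  nabla X (Y - Z) = nabla X Y - nabla X Z.
Proof. by move=> sX sY sZ; rewrite (lc_addr lc sX sY (smooth_vfN sZ)) nablaNr. Qed.

Lemma lieE X Y : smooth_vf X -> smooth_vf Y -> lie X Y = nabla X Y - nabla Y X.
Proof. by move=> sX sY; rewrite (lc_torsion_free lc). Qed.

Let sn X Y : smooth_vf X -> smooth_vf Y -> smooth_vf (nabla X Y).
Proof. exact: (lc_smooth lc). Qed.

Lemma curv_antisym X Y Z : smooth_vf X -> smooth_vf Y -> smooth_vf Z ->
  curv Y X Z = - curv X Y Z.
Proof.
move=> sX sY sZ; rewrite /Defs.curv.
have -> : lie Y X = - lie X Y by rewrite (lieE sX sY) (lieE sY sX) opprB.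
rewrite (nablaNl (smooth_lie sX sY) sZ).
exact: curv_antisym_id.
Qed.

Lemma curvDl X X' Y Z : smooth_vf X -> smooth_vf X' -> smooth_vf Y -> smooth_vf Z ->
  curv (X + X') Y Z = curv X Y Z + curv X' Y Z.
Proof.
move=> sX sX' sY sZ; rewrite /Defs.curv.
have -> : lie (X + X') Y = lie X Y + lie X' Y.
  rewrite (lieE (smooth_vfD sX sX') sY) (lieE sX sY) (lieE sX' sY).
  rewrite (lc_addl lc sX sX' sY) (lc_addr lc sY sX sX').
  exact: lie_add_id.
have sXY := smooth_lie sX sY; have sX'Y := smooth_lie sX' sY.
rewrite (lc_addl lc sXY sX'Y sZ) (lc_addl lc sX sX' sZ).
rewrite (lc_addl lc sX sX' (sn sY sZ)) (lc_addr lc sY (sn sX sZ) (sn sX' sZ)).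
exact: curv_add_id.
Qed.

Lemma curvZl f X Y Z : smooth_map f -> smooth_vf X -> smooth_vf Y -> smooth_vf Z ->
  curv (fun q => f q *: X q) Y Z = fun q => f q *: curv X Y Z q.
Proof.
move=> sf sX sY sZ; rewrite /Defs.curv.
have sfX := smooth_vfZ sf sX.
have sYf := smooth_map_act sY sf.
have -> : lie (fun q => f q *: X q) Y = (fun q => f q *: lie X Y q) - (fun q => act Y f q *: X q).
  rewrite (lieE sfX sY) (lieE sX sY) (lc_scalel lc sf sX sY) (lc_leibniz lc sf sY sX).
  by apply/funext => q; exact: lie_scale_id.
have sXY := smooth_lie sX sY.
rewrite (nablaBl (smooth_vfZ sf sXY) (smooth_vfZ sYf sX) sZ).
rewrite (lc_scalel lc sf sXY sZ) (lc_scalel lc sYf sX sZ) (lc_scalel lc sf sX sZ).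
rewrite (lc_scalel lc sf sX (sn sY sZ)) (lc_leibniz lc sf sY (sn sX sZ)).
by apply/funext => q; exact: curv_scale_id.
Qed.

Lemma curvDr X Y Z Z' : smooth_vf X -> smooth_vf Y -> smooth_vf Z -> smooth_vf Z' ->
  curv X Y (Z + Z') = curv X Y Z + curv X Y Z'.
Proof.
move=> sX sY sZ sZ'; rewrite /Defs.curv.
have sXY := smooth_lie sX sY.
rewrite (lc_addr lc sXY sZ sZ') (lc_addr lc sX sZ sZ') (lc_addr lc sY sZ sZ').
rewrite (lc_addr lc sX (sn sY sZ) (sn sY sZ')) (lc_addr lc sY (sn sX sZ) (sn sX sZ')).
exact: curv_add_id.
Qed.

Lemma curvZr f X Y Z : smooth_map f -> smooth_vf X -> smooth_vf Y -> smooth_vf Z ->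
  curv X Y (fun q => f q *: Z q) = fun q => f q *: curv X Y Z q.
Proof.
move=> sf sX sY sZ; rewrite /Defs.curv.
have sXY := smooth_lie sX sY.
have sYf := smooth_map_act sY sf; have sXf := smooth_map_act sX sf.
rewrite (lc_leibniz lc sf sXY sZ) (lc_leibniz lc sf sX sZ) (lc_leibniz lc sf sY sZ).
rewrite (lc_addr lc sX (smooth_vfZ sYf sZ) (smooth_vfZ sf (sn sY sZ))).
rewrite (lc_addr lc sY (smooth_vfZ sXf sZ) (smooth_vfZ sf (sn sX sZ))).
rewrite (lc_leibniz lc sYf sX sZ) (lc_leibniz lc sXf sY sZ).
rewrite (lc_leibniz lc sf sX (sn sY sZ)) (lc_leibniz lc sf sY (sn sX sZ)).
have -> : act (lie X Y) f = fun q => act X (act Y f) q - act Y (act X f) q.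
  by apply/funext => q; exact: act_lie.
by apply/funext => q; exact: curv_leibniz_id.
Qed.

Lemma curv_antisymE X Y Z q : smooth_vf X -> smooth_vf Y -> smooth_vf Z ->
  curv Y X Z q = - curv X Y Z q.
Proof. by move=> sX sY sZ; rewrite (curv_antisym sX sY sZ). Qed.

Lemma curvE X Y Z : curv X Y Z =
  nabla X (nabla Y Z) - nabla Y (nabla X Z) - nabla (lie X Y) Z.
Proof. by []. Qed.

Lemma smooth_curv X Y Z : smooth_vf X -> smooth_vf Y -> smooth_vf Z ->
  smooth_vf (curv X Y Z).
Proof.
move=> sX sY sZ; rewrite curvE.
exact: (smooth_vfB (smooth_vfB (sn sX (sn sY sZ)) (sn sY (sn sX sZ)))
  (sn (smooth_lie sX sY) sZ)).
Qed.

Opaque Defs.curv.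

(** The passage from the operator [curv], defined on vector fields, to a tensor
    at [p]: one argument at a time, by [tensorial]. *)
Lemma curv_atE X Y Z p : smooth_vf X -> smooth_vf Y -> smooth_vf Z ->
  curv X Y Z p = curv_at p (X p) (Y p) (Z p).
Proof.
move=> sX sY sZ; rewrite /Defs.curv_at.
have [sx xE] := extendP A hausM p (X p); have [sy yE] := extendP A hausM p (Y p).
have [sz zE] := extendP A hausM p (Z p).
transitivity (curv (extend A p (X p)) Y Z p).
  apply: (tensorial (A := A) hausM (p := p) (T := fun X => curv X Y Z p)) => //.
    by move=> U V sU sV; rewrite (curvDl sU sV sY sZ).
  by move=> f U sf sU; rewrite (curvZl sf sU sY sZ).
transitivity (curv (extend A p (X p)) (extend A p (Y p)) Z p).
  apply: (tensorial (A := A) hausM (p := p) (T := fun Y => curv (extend A p (X p)) Y Z p)) => //.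
    move=> U V sU sV; rewrite (curv_antisymE p (smooth_vfD sU sV) sx sZ).
    rewrite (curv_antisymE p sU sx sZ) (curv_antisymE p sV sx sZ) (curvDl sU sV sx sZ).
    exact: opprD.
  move=> f U sf sU; rewrite (curv_antisymE p (smooth_vfZ sf sU) sx sZ).
  by rewrite (curv_antisymE p sU sx sZ) (curvZl sf sU sx sZ) scalerN.
apply: (tensorial (A := A) hausM (p := p)
  (T := fun Z => curv (extend A p (X p)) (extend A p (Y p)) Z p)) => //.
  by move=> U V sU sV; rewrite (curvDr sx sy sU sV).
by move=> f U sf sU; rewrite (curvZr sf sx sy sU).
Qed.

Let ext p v := extend A p v.
Let sext p v : smooth_vf (ext p v). Proof. by have [] := extendP A hausM p v. Qed.
Let extE p v : ext p v p = v. Proof. by have [] := extendP A hausM p v. Qed.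

Lemma curv_atN p u v w : curv_at p v u w = - curv_at p u v w.
Proof. by rewrite /Defs.curv_at curv_antisym. Qed.

Lemma curv_atDl p u u' v w : curv_at p (u + u') v w = curv_at p u v w + curv_at p u' v w.
Proof.
have := @curv_atE (ext p u + ext p u') (ext p v) (ext p w) p.
rewrite !extE fctE !extE => <- //; last exact: smooth_vfD.
by rewrite curvDl.
Qed.

Lemma curv_atZl p a u v w : curv_at p (a *: u) v w = a *: curv_at p u v w.
Proof.
have := @curv_atE (fun q => cst a q *: ext p u q) (ext p v) (ext p w) p.
have sa := @smooth_map_cst _ _ _ A a.
rewrite !extE => <- //; last exact: smooth_vfZ.
by rewrite curvZl.
Qed.

Lemma curv_atDr p u v w w' : curv_at p u v (w + w') = curv_at p u v w + curv_at p u v w'.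
Proof.
have := @curv_atE (ext p u) (ext p v) (ext p w + ext p w') p.
rewrite !extE fctE !extE => <- //; last exact: smooth_vfD.
by rewrite curvDr.
Qed.

(** Both sides act in the same way on functions: third order derivatives cancel
    in pairs. *)
Lemma jacobi X Y Z : smooth_vf X -> smooth_vf Y -> smooth_vf Z ->
  lie X (lie Y Z) + lie Y (lie Z X) + lie Z (lie X Y) = 0.
Proof.
move=> sX sY sZ; apply: (vf_eq_act (A := A) hausM) => f sf.
have [sXY sYZ sZX] : [/\ smooth_vf (lie X Y), smooth_vf (lie Y Z) & smooth_vf (lie Z X)].
  by split; exact: smooth_lie.
have sf' := (smooth_mapP A f).1 sf.
apply/funext => q.
have [D E] : exists D : (M -> 'rV[R]_n) -> (M -> 'rV[R]_n) -> (M -> 'rV[R]_n) -> R,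
    forall U V W, smooth_vf U -> smooth_vf V -> smooth_vf W ->
    act (lie U (lie V W)) f q = D U V W - D U W V - (D V W U - D W V U).
  exists (fun U V W => act U (act V (act W f)) q) => U V W sU sV sW.
  have sVW := smooth_lie sV sW.
  have sa T T' : smooth_vf T -> smooth_vf T' -> smooth_at A q (act T (act T' f)).
    by move=> sT sT'; apply: smooth_at_act => //; exact: smooth_at_act.
  rewrite (act_lie q sU sVW sf) (act_lie q sV sW (smooth_map_act sU sf)).
  congr (_ - _); rewrite -(actB _ (sa V W sV sW) (sa W V sW sV)).
  by apply: act_eq; apply: nearW => q'; exact: act_lie.
rewrite act0 (act_addl _ (sf' q)) (act_addl _ (sf' q)).
have S (a b c a' b' c' : R) : a = a' -> b = b' -> c = c' -> a' + b' + c' = 0 ->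
  a + b + c = 0 by move=> -> -> ->.
apply: (S _ _ _ _ _ _ (E X Y Z sX sY sZ) (E Y Z X sY sZ sX) (E Z X Y sZ sX sY)); ring.
Qed.

(** By the absence of torsion the cyclic sum of the curvature operators is the
    cyclic sum of the iterated brackets, which is zero by [jacobi]. *)
Lemma bianchi X Y Z : smooth_vf X -> smooth_vf Y -> smooth_vf Z ->
  curv X Y Z + curv Y Z X + curv Z X Y = 0.
Proof.
move=> sX sY sZ.
have [sXY sYZ sZX] : [/\ smooth_vf (lie X Y), smooth_vf (lie Y Z) & smooth_vf (lie Z X)].
  by split; exact: smooth_lie.
rewrite -(jacobi sX sY sZ).
rewrite (lieE sX sYZ) (lieE sY sZX) (lieE sZ sXY).
have e U V W : smooth_vf U -> smooth_vf V -> smooth_vf W ->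
    nabla U (lie V W) = nabla U (nabla V W) - nabla U (nabla W V).
  by move=> sU sV sW; rewrite (lieE sV sW) (nablaBr sU (sn sV sW) (sn sW sV)).
rewrite (e X Y Z)// (e Y Z X)// (e Z X Y)// !curvE.
exact: bianchi_id.
Qed.

(** Apply the commutator XY - YX - [X,Y] = 0 to the function g(Z,Z). *)
Lemma curv_metric X Y Z p : smooth_vf X -> smooth_vf Y -> smooth_vf Z ->
  g p (curv X Y Z p) (Z p) = 0.
Proof.
move=> sX sY sZ; have sXY := smooth_lie sX sY.
pose G q := g q (Z q) (Z q).
have sG : smooth_map G by exact: metric_smooth.
have E1 U q : smooth_vf U -> act U G q = 2 * g q (nabla U Z q) (Z q).
  by move=> sU; rewrite /G (lc_metric lc)// (metricC q (Z q)); ring.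
have E2 U V : smooth_vf U -> smooth_vf V -> act U (act V G) p =
    2 * (g p (nabla U (nabla V Z) p) (Z p) + g p (nabla V Z p) (nabla U Z p)).
  move=> sU sV; have sVZ := sn sV sZ.
  have sm := (smooth_mapP A _).1 (metric_smooth sVZ sZ) p.
  transitivity (act U (cst 2 \* (fun q => g q (nabla V Z q) (Z q))) p).
    by apply: act_eq; apply: nearW => q; rewrite E1.
  rewrite (actM _ (@smooth_at_cst _ _ _ A p 2) sm) act_cst mulr0 addr0.
  by rewrite (lc_metric lc).
have := act_lie p sX sY sG.
rewrite (E1 _ _ sXY) (E2 _ _ sX sY) (E2 _ _ sY sX) (metricC p (nabla X Z p)).
have -> : curv X Y Z p =
  nabla X (nabla Y Z) p - nabla Y (nabla X Z) p - nabla (lie X Y) Z p by rewrite curvE.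
rewrite !metricDl !metricNl; lra.
Qed.

Lemma curv_at_metric p u v w z : g p (curv_at p u v w) z = - g p (curv_at p u v z) w.
Proof.
have E x : g p (curv_at p u v x) x = 0.
  by have := curv_metric p (sext p u) (sext p v) (sext p x); rewrite extE.
have := E (w + z); rewrite curv_atDr metricDl !metricDr !E; lra.
Qed.

Lemma curv_at_bianchi p u v w : curv_at p u v w + curv_at p v w u + curv_at p w u v = 0.
Proof. exact: (congr1 (fun X => X p) (bianchi (sext p u) (sext p v) (sext p w))). Qed.

Lemma curv_at_pair p u v w z : g p (curv_at p u v w) z = g p (curv_at p w z u) v.
Proof.
have B a b c d : g p (curv_at p a b c) d + g p (curv_at p b c a) d + g p (curv_at p c a b) d = 0.
  rewrite -!metricDl curv_at_bianchi.
  by rewrite -(scale0r 0) metricZl mul0r.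
have S a b c d : g p (curv_at p a b c) d = - g p (curv_at p b a c) d.
  by rewrite curv_atN metricNl.
exact: pair_symmetry S (curv_at_metric p) B _ _ _ _.
Qed.

End LeviCivita.

(** * Traces in an orthogonal frame *)

Section OrthogonalFrame.
Context {R : realType} {n : nat}.
Local Notation V := 'rV[R]_n.

Record inner_product (g : V -> V -> R) : Prop := InnerProduct {
  ip_sym : forall u v, g u v = g v u;
  ip_add : forall u v w, g u (v + w) = g u v + g u w;
  ip_scale : forall u a v, g u (a *: v) = a * g u v;
  ip_gt0 : forall u, u != 0 -> 0 < g u u
}.

Variable g : V -> V -> R.
Hypothesis ipg : inner_product g.

Lemma ip_addl u v w : g (u + v) w = g u w + g v w.
Proof. by rewrite (ip_sym ipg) (ip_add ipg) !(ip_sym ipg w). Qed.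
Lemma ip_scalel a u w : g (a *: u) w = a * g u w.
Proof. by rewrite (ip_sym ipg) (ip_scale ipg) (ip_sym ipg w). Qed.
Lemma ip0l w : g 0 w = 0.
Proof. by have := ip_scalel 0 0 w; rewrite scale0r mul0r. Qed.
Lemma ip_suml (I : Type) (r : seq I) (F : I -> V) w :
  g (\sum_(i <- r) F i) w = \sum_(i <- r) g (F i) w.
Proof.
elim: r => [|i r IH]; last by rewrite !big_cons ip_addl IH.
by rewrite !big_nil ip0l.
Qed.

Variables (e : 'I_n -> V) (d : 'I_n -> R).
Hypothesis d0 : forall i, d i != 0.
Hypothesis ge : forall i j, g (e i) (e j) = d i *+ (i == j).

Let P : 'M[R]_n := \matrix_i e i.
Let C : 'M[R]_n := \matrix_(k, i) (g 'e_k (e i) / d i).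

Let mulC (w : V) i : (w *m C) 0 i = g w (e i) / d i.
Proof.
rewrite mxE {2}(row_sum_delta w) ip_suml mulr_suml.
by apply: eq_bigr => k _; rewrite mxE ip_scalel mulrA.
Qed.

Let PC : P *m C = 1%:M.
Proof.
apply/row_matrixP => i; apply/rowP => j; rewrite row_mul rowK mulC ge row1 mxE eqxx /=.
by rewrite eq_sym; case: eqVneq => [->|_]; rewrite ?mulr0n ?mul0r// mulr1n divff.
Qed.

Let CP : C *m P = 1%:M. Proof. exact: mulmx1C. Qed.

Lemma frame_decomp w : w = \sum_i (g w (e i) / d i) *: e i.
Proof.
rewrite -{1}[w]mulmx1 -CP mulmxA mulmx_sum_row.
by apply: eq_bigr => i _; rewrite mulC rowK.
Qed.

(** If the rows of [P] are the frame and [C] computes the coordinates in it,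
    then P C = C P = 1, so the trace of L is that of P L C. *)
Lemma trace_frame (L : V -> V) :
  (forall u v, L (u + v) = L u + L v) -> (forall a u, L (a *: u) = a *: L u) ->
  \tr (lin1_mx L) = \sum_i g (L (e i)) (e i) / d i.
Proof.
move=> LD LZ.
have L0 : L 0 = 0 by have := LZ 0 0; rewrite !scale0r.
have LE w : w *m lin1_mx L = L w.
  rewrite {2}(row_sum_delta w) mulmx_sum_row.
  transitivity (\sum_j L (w 0 j *: 'e_j)).
    by apply: eq_bigr => k _; rewrite LZ; congr (_ *: _); apply/rowP => j; rewrite !mxE.
  by elim: (index_enum _) => [|k r IH]; rewrite ?big_nil ?L0// !big_cons LD IH.
rewrite -[lin1_mx L]mulmx1 -CP mulmxA mxtrace_mulC mulmxA /mxtrace.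
apply: eq_bigr => i _.
have -> : (P *m lin1_mx L *m C) i i = (row i (P *m lin1_mx L *m C)) 0 i by rewrite [RHS]mxE.
by rewrite !row_mul rowK LE mulC.
Qed.

End OrthogonalFrame.

(** * Curvature of a three-dimensional contact metric structure at a point *)

Section PointwiseContact.
Context {R : realType}.
Local Notation V := 'rV[R]_3.

Record contact_structure (g : V -> V -> R) (phi : V -> V) (xi : V) (eta : V -> R) : Prop :=
  ContactStructure {
  cs_ip : inner_product g;
  cs_phiZ : forall a u, phi (a *: u) = a *: phi u;
  cs_phiD : forall u v, phi (u + v) = phi u + phi v;
  cs_etaD : forall u v, eta (u + v) = eta u + eta v;
  cs_etaZ : forall a u, eta (a *: u) = a * eta u;
  cs_phi2 : forall v, phi (phi v) = - v + eta v *: xi;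
  cs_eta_xi : eta xi = 1;
  cs_compat : forall u v, g (phi u) (phi v) = g u v - eta u * eta v
}.

Record curvature_tensor (g : V -> V -> R) (Rm : V -> V -> V -> V) : Prop := CurvatureTensor {
  ct_addl : forall u u' v w, Rm (u + u') v w = Rm u v w + Rm u' v w;
  ct_scalel : forall a u v w, Rm (a *: u) v w = a *: Rm u v w;
  ct_anti : forall u v w, Rm v u w = - Rm u v w;
  ct_metric : forall u v w z, g (Rm u v w) z = - g (Rm u v z) w;
  ct_pair : forall u v w z, g (Rm u v w) z = g (Rm w z u) v
}.

Variables (g : V -> V -> R) (phi : V -> V) (xi : V) (eta : V -> R).
Hypothesis cs : contact_structure g phi xi eta.

Let ipg : inner_product g := cs_ip cs.

Let eta0 : eta 0 = 0.
Proof. by have := cs_etaZ cs 0 0; rewrite scale0r mul0r. Qed.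

(** phi^2 xi = 0, hence also phi^3 xi = 0, so phi xi = t xi for some t; then
    phi^2 xi = t^2 xi gives t = 0. *)
Lemma phi_xi : phi xi = 0.
Proof.
have phi0 : phi 0 = 0 by have := cs_phiZ cs 0 0; rewrite !scale0r.
have p2 : phi (phi xi) = 0 by rewrite (cs_phi2 cs) (cs_eta_xi cs) scale1r addNr.
have p3 := cs_phi2 cs (phi xi); rewrite p2 phi0 in p3.
have e : phi xi = eta (phi xi) *: xi.
  by apply/eqP; rewrite -subr_eq0 -oppr_eq0 opprB addrC -p3.
have : eta (phi xi) *: phi xi = 0 by rewrite -(cs_phiZ cs) -e.
by move=> /eqP; rewrite scaler_eq0 => /orP[/eqP t0|/eqP //]; rewrite e t0 scale0r.
Qed.

Lemma etaE v : eta v = g xi v.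
Proof.
have := cs_compat cs xi v; rewrite phi_xi (cs_eta_xi cs) mul1r.
rewrite (ip0l ipg) => /eqP.
by rewrite eq_sym subr_eq0 => /eqP.
Qed.

Lemma eta_phi v : eta (phi v) = 0.
Proof.
have := cs_phi2 cs (phi v); rewrite (cs_phi2 cs v) (cs_phiD cs) (cs_phiZ cs) phi_xi scaler0 addr0.
rewrite -scaleN1r (cs_phiZ cs) scaleN1r => /eqP; rewrite -subr_eq0 opprD addNKr oppr_eq0.
move=> /eqP e; have : eta (eta (phi v) *: xi) = 0.
  by rewrite e eta0.
by rewrite (cs_etaZ cs) (cs_eta_xi cs) mulr1.
Qed.

(** If phi vanished, phi^2 = -1 + eta (x) xi would make every vector a multiple
    of xi, in a space of dimension 3. *)
Lemma exists_phi_neq0 : exists v, phi v != 0.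
Proof.
apply: contrapT => nex.
have E v : v = eta v *: xi.
  have := cs_phi2 cs v; have -> : phi v = 0.
    by apply/eqP/negP => n0; apply: nex; exists v; apply/negP.
  have -> : phi 0 = 0 by have := cs_phiZ cs 0 0; rewrite !scale0r.
  by move=> /eqP; rewrite eq_sym addrC subr_eq0 => /eqP.
have := congr1 (fun w : V => w 0 0) (E 'e_0); rewrite !mxE /= => e00.
have := congr1 (fun w : V => w 0 1) (E 'e_0); rewrite !mxE /= => e01.
have := congr1 (fun w : V => w 0 1) (E 'e_1); rewrite !mxE /= => e11.
have x1 : xi 0 1 = 0.
  apply/eqP; move/esym/eqP : e01; rewrite mulf_eq0 => /orP[/eqP z|//].
  by move: e00; rewrite z mul0r => /eqP; rewrite oner_eq0.
by move: e11; rewrite x1 mulr0 => /eqP; rewrite oner_eq0.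
Qed.

Section Frame.
Variable v : V.
Hypothesis pv : phi v != 0.
(** An orthogonal frame; it is not normalized, so that no square root of
    g(phi v, phi v) appears in expressions that have to depend smoothly on the
    point. *)
Definition frame3 (i : 'I_3) : V := tnth [tuple xi; phi v; phi (phi v)] i.
Definition frame_norm (i : 'I_3) : R := tnth [tuple 1; g (phi v) (phi v); g (phi v) (phi v)] i.
Local Notation a := (phi v).
Local Notation b := (phi (phi v)).
Local Notation q := (g (phi v) (phi v)).

Let q_gt0 : 0 < q. Proof. exact: ip_gt0 pv. Qed.

Let phi_b : phi b = - a.
Proof. by rewrite (cs_phi2 cs) eta_phi scale0r addr0. Qed.
Let gxx : g xi xi = 1. Proof. by rewrite -etaE (cs_eta_xi cs). Qed.
Let gxa : g xi a = 0. Proof. by rewrite -etaE eta_phi. Qed.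
Let gxb : g xi b = 0. Proof. by rewrite -etaE eta_phi. Qed.
Let gbb : g b b = q. Proof. by rewrite (cs_compat cs) eta_phi mul0r subr0. Qed.
Let gab : g a b = 0.
Proof.
have := cs_compat cs a b; rewrite phi_b !eta_phi mul0r subr0.
rewrite -scaleN1r (ip_scale ipg) (ip_sym ipg b); lra.
Qed.

Lemma frame3_orth i j : g (frame3 i) (frame3 j) = frame_norm i *+ (i == j).
Proof.
rewrite /frame3 /frame_norm.
case: i => [[|[|[|//]]] hi]; case: j => [[|[|[|//]]] hj]; rewrite !(tnth_nth 0) /=.
- exact: gxx.
- exact: gxa.
- exact: gxb.
- by rewrite (ip_sym ipg) gxa.
- by [].
- exact: gab.
- by rewrite (ip_sym ipg) gxb.
- by rewrite (ip_sym ipg) gab.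
- exact: gbb.
Qed.

Lemma frame_norm_neq0 i : frame_norm i != 0.
Proof.
have q0 : q != 0 by rewrite gt_eqF// q_gt0.
by case: i => [[|[|[|//]]] hi]; rewrite /frame_norm (tnth_nth 0) /= ?oner_neq0.
Qed.

Let big_ord3 (W : nmodType) (F : 'I_3 -> W) : \sum_i F i = F 0 + F 1 + F 2.
Proof.
rewrite !big_ord_recl big_ord0 addr0 addrA.
by congr (_ + _ + _); congr F; exact: val_inj.
Qed.

Lemma frame3E : (frame3 0 = xi) * (frame3 1 = a) * (frame3 2 = b).
Proof. by rewrite /frame3 !(tnth_nth 0). Qed.
Lemma frame_normE : (frame_norm 0 = 1) * (frame_norm 1 = q) * (frame_norm 2 = q).
Proof. by rewrite /frame_norm !(tnth_nth 0). Qed.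

Lemma contact_decomp w : w = g w xi *: xi + (g w a / q) *: a + (g w b / q) *: b.
Proof.
rewrite {1}(frame_decomp ipg frame_norm_neq0 frame3_orth w) big_ord3 !frame3E !frame_normE.
by rewrite divr1.
Qed.

Lemma contact_ext u w : g u xi = g w xi -> g u a = g w a -> g u b = g w b -> u = w.
Proof. by move=> e1 e2 e3; rewrite (contact_decomp u) (contact_decomp w) e1 e2 e3. Qed.

Variable Rm : V -> V -> V -> V.
Hypothesis ct : curvature_tensor g Rm.
Definition ricci u w := \tr (lin1_mx (fun x => Rm x u w)).

Lemma ricci_frame u w : ricci u w =
  g (Rm xi u w) xi + (g (Rm a u w) a + g (Rm b u w) b) / q.
Proof.
rewrite /ricci (trace_frame ipg frame_norm_neq0 frame3_orth); first last.
- by move=> c x; rewrite (ct_scalel ct).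
- by move=> x y; rewrite (ct_addl ct).
by rewrite big_ord3 !frame3E !frame_normE divr1 mulrDl addrA.
Qed.

(** Covers both the symmetric forms (s = 1, used for the Ricci tensor) and the
    alternating ones (s = -1, used for R(.,.)xi). *)
Lemma form_ext (B : V -> V -> R) (s : R) :
  (forall x x' y, B (x + x') y = B x y + B x' y) ->
  (forall c x y, B (c *: x) y = c * B x y) ->
  (forall x y, B y x = s * B x y) ->
  B xi xi = 0 -> B a a = 0 -> B b b = 0 -> B xi a = 0 -> B xi b = 0 -> B a b = 0 ->
  forall x y, B x y = 0.
Proof.
move=> Dl Zl Bs xx aa bb xa xb ab x y.
have Dr z w w' : B z (w + w') = B z w + B z w'.
  by rewrite Bs Dl mulrDr -!Bs.
have Zr c z w : B z (c *: w) = c * B z w by rewrite Bs Zl mulrCA -Bs.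
have ax : B a xi = 0 by rewrite Bs xa mulr0.
have bx : B b xi = 0 by rewrite Bs xb mulr0.
have ba : B b a = 0 by rewrite Bs ab mulr0.
rewrite (contact_decomp x) (contact_decomp y) !(Dl, Dr, Zl, Zr).
by rewrite xx aa bb xa xb ab ax bx ba !(mulr0, addr0).
Qed.

Local Notation D u v w z := (g (Rm u v w) z).

Lemma ct_addm u u' w z : Rm w (u + u') z = Rm w u z + Rm w u' z.
Proof. by rewrite (ct_anti ct) (ct_addl ct) opprD -!(ct_anti ct). Qed.
Lemma ct_scalem c u w z : Rm w (c *: u) z = c *: Rm w u z.
Proof. by rewrite (ct_anti ct) (ct_scalel ct) -scalerN -(ct_anti ct). Qed.

Let Danti u w x z : D w u x z = - D u w x z.
Proof. by rewrite (ct_anti ct) -scaleN1r (ip_scalel ipg) mulN1r. Qed.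
Let Dmet u w x z : D u w x z = - D u w z x. Proof. exact: (ct_metric ct). Qed.
Let D0l u x z : D u u x z = 0. Proof. have := Danti u u x z; lra. Qed.
Let D0r u w x : D u w x x = 0. Proof. have := Dmet u w x x; lra. Qed.
Let Dpair u w x z : D u w x z = D x z u w. Proof. exact: (ct_pair ct). Qed.

Let q0 : q != 0. Proof. by rewrite gt_eqF// q_gt0. Qed.
Let gax : g a xi = 0. Proof. by rewrite (ip_sym ipg) gxa. Qed.
Let gbx : g b xi = 0. Proof. by rewrite (ip_sym ipg) gxb. Qed.
Let gba : g b a = 0. Proof. by rewrite (ip_sym ipg) gab. Qed.

Lemma ricci_sym u w : ricci u w = ricci w u.
Proof.
have S x : D x u w x = D x w u x by rewrite Dpair Danti Dmet opprK.
by rewrite !ricci_frame (S xi) (S a) (S b).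
Qed.

Lemma ricci_addl u u' w : ricci (u + u') w = ricci u w + ricci u' w.
Proof. by rewrite !ricci_frame !ct_addm !(ip_addl ipg); ring. Qed.
Lemma ricci_scalel c u w : ricci (c *: u) w = c * ricci u w.
Proof. by rewrite !ricci_frame !ct_scalem !(ip_scalel ipg); ring. Qed.

(** In dimension 3 each component of the Ricci tensor in the frame is a single
    curvature component or the sum of two sectional terms. *)
Lemma ricci_ab : ricci a b = D xi a b xi.
Proof. by rewrite ricci_frame D0l D0r; ring. Qed.
Lemma ricci_aa : ricci a a = D xi a a xi + D a b b a / q.
Proof. by rewrite ricci_frame D0l add0r (Dpair b). Qed.
Lemma ricci_bb : ricci b b = D xi b b xi + D a b b a / q.
Proof. by rewrite ricci_frame D0l addr0. Qed.
Lemma ricci_xx : ricci xi xi = (D xi a a xi + D xi b b xi) / q.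
Proof. by rewrite ricci_frame D0l add0r (Dpair a) (Dpair b). Qed.
Lemma ricci_ax : ricci a xi = - D a b xi b / q.
Proof. by rewrite ricci_frame D0r D0l (Danti a); ring. Qed.
Lemma ricci_bx : ricci b xi = D a b xi a / q.
Proof. by rewrite ricci_frame D0r D0l; ring. Qed.

(** Vanishing of Ric(a,b), Ric(a,xi), Ric(b,xi) kills the mixed components of
    R(.,.)xi, the equality of Ric(a,a) and Ric(b,b) makes the two sectional
    curvatures through xi equal, and Ric(xi,xi) is their sum. *)
Lemma einstein_nullity al be :
  (forall u w, ricci u w = al * g u w + be * (eta u * eta w)) ->
  forall u w, Rm u w xi = ((al + be) / 2) *: (g w xi *: u - g u xi *: w).
Proof.
move=> H u w; set k := _ / 2.
have ea : eta a = 0 by exact: eta_phi.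
have eb : eta b = 0 by exact: eta_phi.
have ex := cs_eta_xi cs.
have hab : D xi a b xi = 0 by rewrite -ricci_ab H ea gab; ring.
have hbx : D a b xi a = 0.
  by apply: (mulIf (invr_neq0 q0)); rewrite -ricci_bx H eb gbx; ring.
have hax : D a b xi b = 0.
  by apply: oppr_inj; apply: (mulIf (invr_neq0 q0)); rewrite -ricci_ax H ea gax; ring.
have h1 : D xi a a xi = D xi b b xi.
  have := ricci_aa; have := ricci_bb; rewrite !H ea eb gbb; lra.
have h2 : D xi a a xi = k * q.
  have := ricci_xx; rewrite H ex gxx -h1 => e.
  have : (D xi a a xi + D xi a a xi) = (al + be) * q.
    by apply: (mulIf (invr_neq0 q0)); rewrite -e mulfK//; ring.
  rewrite /k; lra.
have key z : D xi a xi z = - (k * g a z) -> D xi b xi z = - (k * g b z) ->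
    D a b xi z = 0 -> g (Rm u w xi) z = g (k *: (g w xi *: u - g u xi *: w)) z.
  move=> K1 K2 K3; rewrite -(scaleN1r (_ *: w)) !(ip_scalel ipg, ip_addl ipg) mulN1r.
  apply/eqP; rewrite -subr_eq0; apply/eqP.
  apply: (form_ext (B := fun u w => D u w xi z - k * (g w xi * g u z - g u xi * g w z)) (s := -1)).
  - by move=> x x' y; rewrite (ct_addl ct) !(ip_addl ipg); ring.
  - by move=> c x y; rewrite (ct_scalel ct) !(ip_scalel ipg); ring.
  - by move=> x y; rewrite Danti; ring.
  - by rewrite D0l; ring.
  - by rewrite D0l; ring.
  - by rewrite D0l; ring.
  - by rewrite K1 gax gxx; ring.
  - by rewrite K2 gbx gxx; ring.
  - by rewrite K3 gax gbx; ring.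
apply: contact_ext; apply: key; rewrite ?D0r ?gax ?gbx ?gab ?gba ?gbb ?hbx ?hax ?mulr0 ?oppr0//.
- by rewrite Dmet h2.
- by rewrite Dpair Dmet hab oppr0.
- by rewrite Dmet hab oppr0.
- by rewrite Dmet -h1 h2.
Qed.

(** The condition on xi determines all curvature components but the sectional
    curvature of the plane spanned by a and b, which enters Ric(a,a) and
    Ric(b,b) in the same way; Ric(xi,xi) = 2 k then forces the second
    coefficient. *)
Lemma nullity_einstein k :
  (forall u w, Rm u w xi = k *: (g w xi *: u - g u xi *: w)) ->
  forall u w, let al := k + D a b b a / q ^+ 2 in
    ricci u w = al * g u w + (2 * k - al) * (eta u * eta w).
Proof.
move=> H u w al.
have HD x y z : D x y xi z = k * (g y xi * g x z - g x xi * g y z).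
  by rewrite H -(scaleN1r (_ *: y)) !(ip_scalel ipg, ip_addl ipg); ring.
have ea : eta a = 0 by exact: eta_phi.
have eb : eta b = 0 by exact: eta_phi.
have ex := cs_eta_xi cs.
apply/eqP; rewrite -subr_eq0; apply/eqP.
apply: (form_ext (s := 1)
  (B := fun u w => ricci u w - (al * g u w + (2 * k - al) * (eta u * eta w)))).
- by move=> x x' y; rewrite ricci_addl (cs_etaD cs) !(ip_addl ipg); ring.
- by move=> c x y; rewrite ricci_scalel (cs_etaZ cs) !(ip_scalel ipg); ring.
- by move=> x y; rewrite ricci_sym (ip_sym ipg); ring.
- by rewrite ricci_xx !(Dmet xi _ _ xi) !HD ex !gxx gax gbx gbb /al; field.
- by rewrite ricci_aa !(Dmet xi _ _ xi) !HD ea !gxx gax /al; field.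
- by rewrite ricci_bb !(Dmet xi _ _ xi) !HD eb !gxx gbx gbb /al; field.
- by rewrite ricci_sym ricci_ax HD gxa ea gax gbx; ring.
- by rewrite ricci_sym ricci_bx HD gxb eb gax gbx; ring.
- by rewrite ricci_ab !(Dmet xi _ _ xi) !HD ea eb gab gxx gax gxb; ring.
Qed.

End Frame.
End PointwiseContact.

(** * Smoothness and conclusion *)

Section MainTheorem.
Context {R : realType} {M : topologicalType}.
Variables (A : atlas R 3 M)
  (phi : M -> 'rV[R]_3 -> 'rV[R]_3) (xi : M -> 'rV[R]_3)
  (eta : M -> 'rV[R]_3 -> R) (g : M -> 'rV[R]_3 -> 'rV[R]_3 -> R)
  (nabla : (M -> 'rV[R]_3) -> (M -> 'rV[R]_3) -> M -> 'rV[R]_3).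
Hypothesis hausM : hausdorff_space M.
Hypothesis acm : almost_contact_metric A phi xi eta g.
Hypothesis lc : levi_civita A g nabla.

Let rg : riemannian A g := acm_g acm.

Lemma inner_product_at p : inner_product (g p).
Proof.
split.
- exact: (metricC rg).
- exact: (metricDr rg).
- exact: (metricZr rg).
- by have [_ _ + _] := rg; apply.
Qed.

Lemma contact_structure_at p : contact_structure (g p) (phi p) (xi p) (eta p).
Proof.
have [phil _] := acm_phi acm; have [etal _] := acm_eta acm.
have phiD u v : phi p (u + v) = phi p u + phi p v.
  by have := phil p 1 u v; rewrite !scale1r.
have phi0 : phi p 0 = 0 by apply: (addrI (phi p 0)); rewrite -phiD !addr0.
have etaD u v : eta p (u + v) = eta p u + eta p v.
  by have /= := etal p 1 u v; rewrite scale1r mul1r.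
have eta0 : eta p 0 = 0 by apply: (addrI (eta p 0)); rewrite -etaD !addr0.
split => //.
- exact: inner_product_at.
- by move=> a u; have := phil p a u 0; rewrite !addr0 phi0 addr0.
- by move=> a u; have /= := etal p a u 0; rewrite !addr0 eta0 addr0.
- exact: (acm_phi2 acm).
- exact: (acm_eta_xi acm).
- exact: (acm_compat acm).
Qed.

Lemma curvature_tensor_at p : curvature_tensor (g p) (curv_at A nabla p).
Proof.
split.
- exact: (curv_atDl hausM lc).
- exact: (curv_atZl hausM lc).
- exact: (curv_atN hausM lc).
- exact: (curv_at_metric hausM rg lc).
- exact: (curv_at_pair hausM rg lc).
Qed.

Let phi_curv p w := g p (curv_at A nabla p (phi p w) (phi p (phi p w)) (phi p (phi p w))) (phi p w).
Let phi_norm p w := g p (phi p w) (phi p w).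

Lemma eta_Einstein_nullity : eta_Einstein A nabla eta g ->
  exists kappa : M -> R,
    smooth_map A kappa /\ forall p : M, nullity A nabla g kappa p (xi p).
Proof.
move=> [a [b [/smooth_mapP sa /smooth_mapP sb H]]]; exists (fun p => (a p + b p) / 2).
split=> [|p u w].
  apply/smooth_mapP => p.
  exact: (smooth_atM (smooth_atD (sa p) (sb p)) (@smooth_at_cst _ _ _ A p 2^-1)).
have [v pv] := exists_phi_neq0 (contact_structure_at p).
exact: (einstein_nullity (contact_structure_at p) pv (curvature_tensor_at p) (H p)).
Qed.

(** The pointwise coefficient is k + K, with K the sectional curvature of the
    plane orthogonal to xi. To see that K is smooth near [p] it is computed
    with a smooth field [X] that extends a vector not annihilated by phi: K is
    then g(R(a,b)b,a) / g(a,a)^2 with a = phi X and b = phi^2 X, and the value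
    is the same as with the chosen vectors because Ric(a,a) is. *)
Lemma nullity_eta_Einstein (kappa : M -> R) : smooth_map A kappa ->
  (forall p : M, nullity A nabla g kappa p (xi p)) -> eta_Einstein A nabla eta g.
Proof.
move=> sk N.
have /choice[v pv] : forall p, exists v, phi p v != 0.
  by move=> p; exact: (exists_phi_neq0 (contact_structure_at p)).
pose coef p w := kappa p + phi_curv p w / phi_norm p w ^+ 2.
pose a p := coef p (v p).
have E p w : phi p w != 0 -> forall x y, Ric A nabla p x y =
    coef p w * g p x y + (2 * kappa p - coef p w) * (eta p x * eta p y).
  move=> pw.
  exact: (nullity_einstein (contact_structure_at p) pw (curvature_tensor_at p) (N p)).
(* compare the two expressions of Ric(phi w, phi w) *)
have aE p w : phi p w != 0 -> a p = coef p w.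
  move=> pw; have := E p w pw (phi p w) (phi p w); rewrite (E p (v p) (pv p)).
  rewrite (eta_phi (contact_structure_at p)) !mulr0 !addr0; apply: mulIf.
  by rewrite gt_eqF// (ip_gt0 (inner_product_at p)).
have sa : smooth_map A a.
  apply/smooth_mapP => p.
  have [sX XE] := extendP A hausM p (v p); set X := extend A p (v p) in sX XE.
  have [_ sphi] := acm_phi acm.
  have sY := sphi _ sX; have sZ := sphi _ sY; have sC := smooth_curv lc sY sZ sZ.
  have sQ := (smooth_mapP A _).1 (metric_smooth rg sY sY) p.
  have sF := (smooth_mapP A _).1 (metric_smooth rg sC sY) p.
  have Qp : g p (phi p (X p)) (phi p (X p)) != 0.
    by rewrite XE gt_eqF// (ip_gt0 (inner_product_at p)).
  have sI := smooth_atV sQ Qp.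
  have := smooth_atD ((smooth_mapP A _).1 sk p) (smooth_atM sF (smooth_atM sI sI)).
  apply: smooth_at_eq; near=> r.
  have Qr : g r (phi r (X r)) (phi r (X r)) != 0 by near: r; exact: (smooth_at_neq0 sQ Qp).
  have pr : phi r (X r) != 0.
    by apply: contra Qr => /eqP ->; rewrite (ip0l (inner_product_at r)).
  by rewrite (aE r (X r) pr) /coef /= (curv_atE hausM lc r sY sZ sZ) -invfM -expr2.
exists a, (fun p => 2 * kappa p - a p); split=> // [|p u w]; last exact: E.
apply/smooth_mapP => p; have sk' := (smooth_mapP A _).1 sk p.
exact: (smooth_atB (smooth_atM (@smooth_at_cst _ _ _ A p 2) sk') ((smooth_mapP A _).1 sa p)).
Unshelve. all: by end_near. Qed.

End MainTheorem.

Theorem proposition3p1 (R : realType) (M : topologicalType) (A : atlas R 3 M)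
  (phi : M -> 'rV[R]_3 -> 'rV[R]_3) (xi : M -> 'rV[R]_3)
  (eta : M -> 'rV[R]_3 -> R) (g : M -> 'rV[R]_3 -> 'rV[R]_3 -> R)
  (nabla : (M -> 'rV[R]_3) -> (M -> 'rV[R]_3) -> M -> 'rV[R]_3)
  (hM : smooth_manifold A)
  (hK : almost_Kenmotsu A phi xi eta g)
  (hnabla : levi_civita A g nabla) :
  eta_Einstein A nabla eta g <->
  exists kappa : M -> R,
    smooth_map A kappa /\ forall p : M, nullity A nabla g kappa p (xi p).
Proof.
have [hausM _ _] := hM; have [acm _ _] := hK.
split=> [|[kappa [sk N]]]; first exact: (eta_Einstein_nullity hausM acm hnabla).
exact: (nullity_eta_Einstein hausM acm hnabla sk N).
Qed.
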